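(* Let $n\ge2$. Let $u:\mathbb R\times(0,\infty)\to\mathbb R$ be twice continuously differentiable in $x$ and continuously differentiable in $t$, with $\partial_tu-\partial_x^2u=0$ on $\mathbb R\times(0,\infty)$. Suppose $u(\cdot,t)\in\mathcal A_c^n$ for each $t>0$, $\|u(\cdot,t)\|^{(n)}$ is bounded for $t\in(0,\infty)$, and $\lim_{t\to0^+}\|u(\cdot,t)-f\|^{(n)}=0$ for some $f\in\mathcal A_c^n$. Then $u(x,t)=f\ast\Theta_t(x)$ for all $(x,t)\in\mathbb R\times(0,\infty)$; i.e., $f\ast\Theta_t$ is the unique solution with these properties.
   Context: Let $\mathcal B_c$ be the set of continuous $F:\mathbb R\to\mathbb R$ such that $\lim_{x\to\pm\infty}F(x)$ exist as real numbers and $\lim_{x\to-\infty}F(x)=0$. $\mathcal A_c$ is the set of distributions $F'$ with $F\in\mathcal B_c$, with integral $\int_a^bF'=F(b)-F(a)$ and, for $g$ of bounded variation, $\int_{-\infty}^\infty F'g:=F(\infty)g(\infty)-\int F\,dg$ (Henstock–Stieltjes). For $n\in\mathbb N$, $\mathcal A_c^n$ is the set of distributions $f=F^{(n)}$ (distributional derivative) for some $F\in\mathcal B_c$; this $F$ is unique, and $\|f\|^{(n)}:=\sup_{x<y}|F(x)-F(y)|$. For $f\in\mathcal A_c^n$ with primitive $F$, $f\ast\Theta_t(x):=\int_{-\infty}^\infty F'(\xi)\Theta_t^{(n-1)}(x-\xi)\,d\xi$ (integral in $\mathcal A_c$), where $\Theta_t(x)=(4\pi t)^{-1/2}e^{-x^2/(4t)}$,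 $t>0$, and $\Theta_t^{(k)}$ is its $k$th $x$-derivative. *)

(* Defs.v *)
From Stdlib Require Import Reals.
From Coquelicot Require Import Coquelicot.
Open Scope R_scope.

Definition in_Bc (F : R -> R) : Prop :=
  (forall x, continuous F x) /\
  is_lim F m_infty 0 /\
  (exists l : R, is_lim F p_infty l).

Definition smooth (phi : R -> R) : Prop := forall (k : nat) (x : R), ex_derive_n phi k x.
Definition supp_in (phi : R -> R) (a b : R) : Prop :=
  forall x, x < a \/ b < x -> phi x = 0.

Definition dist_deriv_eq (n : nat) (F g : R -> R) : Prop :=
  forall (phi : R -> R) (a b : R), a <= b -> smooth phi -> supp_in phi a b ->
    RInt (fun x => F x * Derive_n phi n x) a b
    = (-1) ^ n * RInt (fun x => g x * phi x) a b.

(* ||f||^(n) = sup_{x<y} |F(x) - F(y)|, F the primitive in B_c of f *)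
Definition Anorm (F : R -> R) : R :=
  real (Lub_Rbar (fun r => exists x y, x < y /\ r = Rabs (F x - F y))).

Definition Theta (t x : R) : R := / sqrt (4 * PI * t) * exp (- (x ^ 2) / (4 * t)).
Definition Theta_d (k : nat) (t x : R) : R := Derive_n (Theta t) k x.

(* f * Theta_t (x) for f = F^(n), F in B_c:
   the A_c integral  int F'(xi) g(xi) dxi  with  g(xi) = Theta_t^(n-1)(x - xi),
   i.e. F(oo) g(oo) - int F dg, where, g being C^1, the Stieltjes integral
   int F dg is the (improper) integral of F * g'. *)
Definition heat_conv (n : nat) (F : R -> R) (t x : R) : R :=
  let g := fun xi => Theta_d (n - 1) t (x - xi) in
  real (Lim F p_infty) * real (Lim g p_infty)
  - RInt_gen (fun xi => F xi * Derive g xi) (Rbar_locally m_infty) (Rbar_locally p_infty).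

(* Main.v *)
(* Fix x0 and T, let s0 > 0, S = s0 + T, K_s(y) = Theta_{S-s}(x0 - y), and let chi
   be a smooth cutoff equal to 1 on [a, b] and to 0 off [a - 1, b + 1]. As K solves
   the backward heat equation, J(s) = int u(y,s) K_s(y) chi(y) dy satisfies
   J'(s) = int u (2 K_s' chi' + K_s chi''), which is (-1)^n times the integral of the
   primitive U of u against the n-th derivative of a function living on
   [a - 1, a] and [b, b + 1]. Since U is bounded and the derivatives of
   Theta_t(z) are O(1/z^2) uniformly in t <= T, J is constant up to an error that
   vanishes as a -> -oo and b -> oo. As s -> S, J(s) tends to u(x0, S), while
   J(s0) = (-1)^n int U(y,s0) (Theta_T(x0 - y) chi(y))^(n) dy, in which one may let
   s0 -> 0 under the integral. *)

(* The hypotheses control only the primitive [U] of [u(.,t)], uniformly in [x]; they give no growth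
   bound for [u] itself, so an integral of [u] against the full kernel need not converge. The cutoff
   answers both to this and to [dist_deriv_eq], which admits only compactly supported test
   functions; every error term is moved onto [U] before it is estimated. With [S = s0 + T] the
   kernel at [s = s0] is always [Theta_T], so in [J(s0)] only [u] depends on [s0]. A positive [s0]
   is needed because nothing is assumed pointwise about [u] at [t = 0]. Three limits are taken in
   turn: [s -> S], [s0 -> 0], then [a -> -oo] and [b -> oo]. They are compatible because the error
   constant is fixed before [s0], [a] and [b]; for this the derivatives of the cutoffs must be
   bounded independently of [a] and [b]. The first limit needs the kernel to have total mass exactly
   1, hence the evaluation of the Gaussian integral. *)
Require Import Defs.
From Stdlib Require Import Reals Lra Lia Factorial ClassicalEpsilon FunctionalExtensionality.
From Coquelicot Require Import Coquelicot.
Open Scope R_scope.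

(** * Smooth functions *)

(** Peels off the innermost derivative, whereas [smooth] speaks of the outermost one. Closure under
    sums, products and affine substitutions then follows by induction on [k]. *)
Fixpoint Ck (k : nat) (f : R -> R) : Prop :=
  match k with
  | O => True
  | S k' => (forall x, ex_derive f x) /\ Ck k' (Derive f)
  end.

Lemma Derive_n_Derive f k x : Derive_n (Derive f) k x = Derive_n f (S k) x.
Proof.
  change (Derive f) with (Derive_n f 1).
  rewrite Derive_n_comp. f_equal. lia.
Qed.

Lemma smooth_Derive f : smooth f -> smooth (Derive f).
Proof.
  intros Hf k x. destruct k as [|k]; [exact I|].
  apply ex_derive_ext with (Derive_n f (S k)).
  - intros t. symmetry. apply Derive_n_Derive.
  - apply (Hf (S (S k))).
Qed.

Lemma smooth_Derive_n f k : smooth f -> smooth (Derive_n f k).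
Proof.
  intros Hf. induction k as [|k IH]; [exact Hf|]. exact (smooth_Derive _ IH).
Qed.

Lemma smooth_ex_derive f x : smooth f -> ex_derive f x.
Proof. intros Hf. exact (Hf 1%nat x). Qed.

Lemma smooth_continuous f k x : smooth f -> continuous (Derive_n f k) x.
Proof. intros Hf. apply (@ex_derive_continuous R_AbsRing R_NormedModule). exact (Hf (S k) x). Qed.

Lemma smooth_Ck f : smooth f <-> forall k, Ck k f.
Proof.
  split.
  - intros Hf k. revert f Hf. induction k as [|k IH]; intros f Hf; [exact I|].
    split.
    + intros x. now apply smooth_ex_derive.
    + now apply IH, smooth_Derive.
  - intros H k x. destruct k as [|k]; [exact I|].
    specialize (H (S k)). revert f H. induction k as [|k IH]; intros f [H1 H2].
    + apply H1.
    + apply ex_derive_ext with (Derive_n (Derive f) k).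
      * intros t. apply Derive_n_Derive.
      * exact (IH _ H2).
Qed.

Lemma Ck_pred k f : Ck (S k) f -> Ck k f.
Proof.
  revert f. induction k as [|k IH]; intros f; [easy|].
  intros [H1 H2]. split; [exact H1|]. now apply IH.
Qed.

Lemma Ck_plus k f g : Ck k f -> Ck k g -> Ck k (fun x => f x + g x).
Proof.
  revert f g. induction k as [|k IH]; intros f g; [easy|].
  intros [Hf Hf'] [Hg Hg']. split.
  - intros x. now apply @ex_derive_plus.
  - replace (Derive (fun x => f x + g x)) with (fun x => Derive f x + Derive g x).
    + now apply IH.
    + apply functional_extensionality. intros x. now rewrite Derive_plus.
Qed.

Lemma Derive_mult_fun f g : (forall x, ex_derive f x) -> (forall x, ex_derive g x) ->
  Derive (fun x => f x * g x) = (fun x => Derive f x * g x + f x * Derive g x).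
Proof.
  intros Hf Hg. apply functional_extensionality. intros x. now rewrite Derive_mult.
Qed.

Lemma Ck_mult k f g : Ck k f -> Ck k g -> Ck k (fun x => f x * g x).
Proof.
  revert f g. induction k as [|k IH]; intros f g; [easy|].
  intros Hf Hg. pose proof (Ck_pred _ _ Hf). pose proof (Ck_pred _ _ Hg).
  destruct Hf as [Hf Hf'], Hg as [Hg Hg']. split.
  - intros x. now apply ex_derive_mult.
  - rewrite Derive_mult_fun; auto. apply Ck_plus; now apply IH.
Qed.

Lemma smooth_plus f g : smooth f -> smooth g -> smooth (fun x => f x + g x).
Proof. rewrite !smooth_Ck. intros Hf Hg k. now apply Ck_plus. Qed.

Lemma smooth_mult f g : smooth f -> smooth g -> smooth (fun x => f x * g x).
Proof. rewrite !smooth_Ck. intros Hf Hg k. now apply Ck_mult. Qed.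

Lemma smooth_const c : smooth (fun _ => c).
Proof. intros k x. apply ex_derive_n_const. Qed.

Lemma smooth_id : smooth (fun x => x).
Proof.
  apply smooth_Ck. intros [|k]; [exact I|]. split.
  - intros x. apply ex_derive_id.
  - replace (Derive (fun x : R => x)) with (fun _ : R => 1).
    + apply smooth_Ck, smooth_const.
    + apply functional_extensionality. intros x. now rewrite Derive_id.
Qed.

Lemma smooth_antiderivative f df :
  (forall x, is_derive f x (df x)) -> smooth df -> smooth f.
Proof.
  intros H Hd. apply smooth_Ck. intros [|k]; [exact I|]. split.
  - intros x. now exists (df x).
  - replace (Derive f) with df.
    + now apply smooth_Ck.
    + apply functional_extensionality. intros x. symmetry. now apply is_derive_unique.
Qed.

(** Bootstrapping: if [f] is [Ck k], so is its derivative [g * f], and hence [f] is [Ck (S k)]. *)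
Lemma smooth_linear_ode f g :
  (forall x, is_derive f x (g x * f x)) -> smooth g -> smooth f.
Proof.
  intros H Hg. apply smooth_Ck. intros k.
  induction k as [|k IH]; [exact I|]. split.
  - intros x. eexists. apply H.
  - replace (Derive f) with (fun x => g x * f x).
    + apply Ck_mult; [now apply smooth_Ck | exact IH].
    + apply functional_extensionality. intros x. symmetry. now apply is_derive_unique.
Qed.

Lemma Derive_affine f m c : (forall x, ex_derive f x) ->
  Derive (fun y => f (m * y + c)) = (fun y => m * Derive f (m * y + c)).
Proof.
  intros Hf. apply functional_extensionality. intros y. apply is_derive_unique.
  auto_derive; [apply Hf | change (fun x => f x) with f; ring].
Qed.

Lemma smooth_affine f m c : smooth f -> smooth (fun y => f (m * y + c)).
Proof.
  intros Hf. apply smooth_Ck. intros k. revert f Hf.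
  induction k as [|k IH]; intros f Hf; [exact I|].
  assert (Hd : forall x, ex_derive f x) by (intros x; now apply smooth_ex_derive).
  split.
  - intros x. auto_derive. apply Hd.
  - rewrite Derive_affine; [|exact Hd].
    apply Ck_mult; [apply smooth_Ck, smooth_const | now apply IH, smooth_Derive].
Qed.

Lemma Derive_n_affine f m c k y : smooth f ->
  Derive_n (fun y => f (m * y + c)) k y = m ^ k * Derive_n f k (m * y + c).
Proof.
  revert f. induction k as [|k IH]; intros f Hf; [simpl; ring|].
  rewrite <- Derive_n_Derive, Derive_affine by (intros x; now apply smooth_ex_derive).
  rewrite Derive_n_scal_l, IH by now apply smooth_Derive.
  rewrite Derive_n_Derive. simpl. ring.
Qed.

Lemma Derive_n_plus_smooth f g k x : smooth f -> smooth g ->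
  Derive_n (fun y => f y + g y) k x = Derive_n f k x + Derive_n g k x.
Proof.
  intros Hf Hg. apply Derive_n_plus; apply filter_forall; intros; [apply Hf | apply Hg].
Qed.

(** Each differentiation splits a product into two products of the same kind, whence [2 ^ n], the
    sum of the binomial coefficients in the Leibniz rule. *)
Lemma Derive_n_mult_bound f g x A B n : smooth f -> smooth g ->
  (forall k, (k <= n)%nat -> Rabs (Derive_n f k x) <= A) ->
  (forall k, (k <= n)%nat -> Rabs (Derive_n g k x) <= B) ->
  Rabs (Derive_n (fun y => f y * g y) n x) <= 2 ^ n * (A * B).
Proof.
  revert f g. induction n as [|n IH]; intros f g Hf Hg HA HB.
  - simpl. rewrite Rabs_mult, Rmult_1_l.
    apply Rmult_le_compat; try apply Rabs_pos; [now apply (HA O) | now apply (HB O)].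
  - pose proof (smooth_Derive _ Hf). pose proof (smooth_Derive _ Hg).
    rewrite <- Derive_n_Derive, Derive_mult_fun by (intros z; now apply smooth_ex_derive).
    rewrite Derive_n_plus_smooth by now apply smooth_mult.
    eapply Rle_trans; [apply Rabs_triang|].
    replace (2 ^ S n * (A * B)) with (2 ^ n * (A * B) + 2 ^ n * (A * B)) by (simpl; ring).
    apply Rplus_le_compat; apply IH; auto; intros k Hk; rewrite ?Derive_n_Derive;
      first [apply HA | apply HB]; lia.
Qed.

Lemma Derive_n_locally_const f c k x : locally x (fun y => f y = c) ->
  (1 <= k)%nat -> Derive_n f k x = 0.
Proof.
  intros H Hk. rewrite (Derive_n_ext_loc f (fun _ => c) k x H).
  destruct k as [|k]; [lia | apply Derive_n_const].
Qed.

(** * A smooth step function *)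

(** The index [m] makes the family stable under differentiation up to linear combinations, so all
    orders of smoothness come from one induction. *)
Definition flat (m : nat) (x : R) : R :=
  if Rlt_dec 0 x then (/ x) ^ m * exp (- / x) else 0.

Lemma pow_le_fact_exp m y : 0 <= y -> y ^ m <= INR (fact m) * exp y.
Proof.
  intros Hy. assert (Hf := INR_fact_lt_0 m).
  replace (y ^ m) with (INR (fact m) * (y ^ m / INR (fact m))) by (field; lra).
  apply Rmult_le_compat_l; [lra|].
  eapply Rle_trans; [|apply (exp_ge_taylor y m Hy)].
  destruct m as [|m]; [simpl; lra|].
  rewrite tech5. rewrite <- (Rplus_0_l (_ / _)) at 1. apply Rplus_le_compat_r.
  apply cond_pos_sum. intros k. apply Rmult_le_pos; [now apply pow_le|].
  apply Rlt_le, Rinv_0_lt_compat, INR_fact_lt_0.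
Qed.

(** A single term of the exponential series already gives this. It serves twice: for flatness at 0
    with [y = 1/x], and for Gaussian tails with [y = x^2/(4t)]. *)
Lemma exp_neg_le_pow m y : 0 < y -> exp (- y) <= INR (fact m) * (/ y) ^ m.
Proof.
  intros Hy. assert (Hm := pow_lt y m Hy). assert (He := exp_pos y).
  rewrite exp_Ropp, pow_inv. apply (Rmult_le_reg_r (exp y * y ^ m)); [nra|].
  replace (/ exp y * (exp y * y ^ m)) with (y ^ m) by (field; lra).
  replace (INR (fact m) * / y ^ m * (exp y * y ^ m)) with (INR (fact m) * exp y) by (field; lra).
  apply pow_le_fact_exp. lra.
Qed.

Lemma flat_pos m x : 0 < x -> flat m x = (/ x) ^ m * exp (- / x).
Proof. intros H. unfold flat. destruct (Rlt_dec 0 x); lra. Qed.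

Lemma flat_neg m x : x <= 0 -> flat m x = 0.
Proof. intros H. unfold flat. destruct (Rlt_dec 0 x); lra. Qed.

(** The power [m + 2] of the exponential bound beats [x^(-m)] and leaves [x^2], which is what forces
    a zero derivative at the origin. *)
Lemma flat_bound m x : Rabs (flat m x) <= INR (fact (m + 2)) * x ^ 2.
Proof.
  assert (Hf := INR_fact_lt_0 (m + 2)).
  destruct (Rlt_dec 0 x) as [H|H].
  - assert (Hi := Rinv_0_lt_compat x H). assert (Hm := pow_lt _ m Hi).
    rewrite flat_pos by assumption. rewrite Rabs_pos_eq.
    2:{ apply Rmult_le_pos; [lra | apply Rlt_le, exp_pos]. }
    replace (INR (fact (m + 2)) * x ^ 2)
      with ((/ x) ^ m * (INR (fact (m + 2)) * (/ / x) ^ (m + 2))).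
    + apply Rmult_le_compat_l; [lra|]. now apply exp_neg_le_pow.
    + rewrite Rinv_inv, pow_add, pow_inv. field. apply pow_nonzero. lra.
  - rewrite flat_neg by lra. rewrite Rabs_R0. apply Rmult_le_pos; [lra|]. apply pow2_ge_0.
Qed.

Lemma is_derive_flat m x :
  is_derive (flat m) x (flat (m + 2) x - INR m * flat (m + 1) x).
Proof.
  destruct (Rtotal_order x 0) as [H|[H|H]].
  - rewrite !flat_neg by lra. replace (0 - INR m * 0) with 0 by ring.
    apply is_derive_ext_loc with (fun _ => 0).
    + apply (filter_imp (fun y => y < 0)); [|now apply open_lt].
      intros y Hy. symmetry. apply flat_neg. lra.
    + apply (@is_derive_const R_AbsRing R_NormedModule).
  - subst x. rewrite !flat_neg by lra. replace (0 - INR m * 0) with 0 by ring.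
    apply is_derive_Reals. intros eps Heps.
    set (K := INR (fact (m + 2))). assert (HK : 0 < K) by apply INR_fact_lt_0.
    assert (Hd : 0 < eps / K) by (apply Rdiv_lt_0_compat; assumption).
    exists (mkposreal _ Hd). simpl. intros h Hh Hlt.
    rewrite Rplus_0_l, (flat_neg m 0) by lra. rewrite !Rminus_0_r.
    assert (Ha : 0 < Rabs h) by now apply Rabs_pos_lt.
    unfold Rdiv. rewrite Rabs_mult, Rabs_inv.
    apply Rle_lt_trans with (K * Rabs h).
    + apply (Rmult_le_reg_r (Rabs h)); [assumption|].
      replace (Rabs (flat m h) * / Rabs h * Rabs h) with (Rabs (flat m h)) by (field; lra).
      eapply Rle_trans; [apply flat_bound|]. fold K.
      rewrite <- (pow2_abs h). right. ring.
    + apply (Rmult_lt_compat_l K) in Hlt; [|assumption].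
      replace (K * (eps / K)) with eps in Hlt by (field; lra). exact Hlt.
  - apply is_derive_ext_loc with (fun y => (/ y) ^ m * exp (- / y)).
    + apply (filter_imp (fun y => 0 < y)); [|now apply open_gt].
      intros y Hy. symmetry. now apply flat_pos.
    + rewrite !flat_pos by assumption. auto_derive; [lra|].
      rewrite !pow_add. destruct m as [|m]; [simpl; field; lra|].
      rewrite Nat.pred_succ, <- !tech_pow_Rmult. field. lra.
Qed.

Lemma smooth_flat m : smooth (flat m).
Proof.
  apply smooth_Ck. intros k. revert m.
  induction k as [|k IH]; intros m; [exact I|]. split.
  - intros x. eexists. apply is_derive_flat.
  - replace (Derive (flat m))
      with (fun x => flat (m + 2) x + (- INR m) * flat (m + 1) x).
    + apply Ck_plus; [apply IH|]. apply Ck_mult; [apply smooth_Ck, smooth_const | apply IH].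
    + apply functional_extensionality. intros x. symmetry. apply is_derive_unique.
      replace (flat (m + 2) x + - INR m * flat (m + 1) x)
        with (flat (m + 2) x - INR m * flat (m + 1) x) by ring.
      apply is_derive_flat.
Qed.

(** A normalized antiderivative of a bump on [[0, 1]]. Its derivatives are bounded by compactness on
    [[0, 1]] and because the function is locally constant elsewhere. *)
Lemma exists_smooth_step : exists St : R -> R, smooth St /\
  (forall x, x <= 0 -> St x = 0) /\ (forall x, 1 <= x -> St x = 1) /\
  (forall k, exists M, forall x, Rabs (Derive_n St k x) <= M).
Proof.
  set (b := fun x => flat 0 x * flat 0 ((-1) * x + 1)).
  assert (Hb : smooth b).
  { apply smooth_mult; [|apply smooth_affine]; apply smooth_flat. }
  assert (Hc : forall x, continuous b x) by (intros x; apply (smooth_continuous b 0 x Hb)).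
  assert (Hi : forall x y, ex_RInt b x y).
  { intros x y. apply (ex_RInt_continuous (V := R_CompleteNormedModule)). auto. }
  set (c := RInt b 0 1).
  assert (Hpos : 0 < c).
  { apply RInt_gt_0; [lra| |auto].
    intros x Hx. unfold b. rewrite !flat_pos by lra. simpl.
    apply Rmult_lt_0_compat; rewrite Rmult_1_l; apply exp_pos. }
  assert (H0 : forall x y, x <= y -> (y <= 0 \/ 1 <= x) -> RInt b x y = 0).
  { intros x y Hxy H. rewrite (RInt_ext b (fun _ => 0)).
    - rewrite RInt_const. apply Rmult_0_r.
    - rewrite Rmin_left, Rmax_right by lra. intros z Hz. unfold b.
      destruct H.
      + rewrite (flat_neg 0 z) by lra. apply Rmult_0_l.
      + rewrite (flat_neg 0 (-1 * z + 1)) by lra. apply Rmult_0_r. }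
  set (St := fun x => / c * RInt b 0 x).
  assert (HS : smooth St).
  { apply smooth_mult; [apply smooth_const|]. apply smooth_antiderivative with b; [|exact Hb].
    intros x. apply (is_derive_RInt b (RInt b 0) 0 x); [|apply Hc].
    apply filter_forall. intros y. apply (RInt_correct (V := R_CompleteNormedModule)). auto. }
  assert (Sl : forall x, x <= 0 -> St x = 0).
  { intros x Hx. unfold St. rewrite <- (opp_RInt_swap b x 0) by auto.
    rewrite H0 by lra. unfold opp; simpl. ring. }
  assert (Sr : forall x, 1 <= x -> St x = 1).
  { intros x Hx. unfold St. rewrite <- (RInt_Chasles b 0 1 x) by auto.
    rewrite (H0 1 x) by lra. unfold plus; simpl. fold c. field. lra. }
  exists St. repeat split; auto.
  intros k.
  destruct (bounded_continuity (V := R_NormedModule) (Derive_n St k) 0 1) as [M HM].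
  { intros x _. now apply smooth_continuous. }
  exists (Rmax M 1). intros x.
  destruct (Rle_dec 0 x) as [Hx0|Hx0]; [destruct (Rle_dec x 1) as [Hx1|Hx1]|].
  - eapply Rle_trans; [|apply Rmax_l]. apply Rlt_le, (HM x). lra.
  - eapply Rle_trans; [|apply Rmax_r]. destruct k as [|k].
    + simpl. rewrite Sr by lra. rewrite Rabs_R1. lra.
    + rewrite (Derive_n_locally_const St 1); [rewrite Rabs_R0; lra| |lia].
      apply (filter_imp (fun y => 1 < y)); [|apply open_gt; lra]. intros y Hy. apply Sr. lra.
  - eapply Rle_trans; [|apply Rmax_r]. destruct k as [|k].
    + simpl. rewrite Sl by lra. rewrite Rabs_R0. lra.
    + rewrite (Derive_n_locally_const St 0); [rewrite Rabs_R0; lra| |lia].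
      apply (filter_imp (fun y => y < 0)); [|apply open_lt; lra]. intros y Hy. apply Sl. lra.
Qed.

(** [M] is a parameter so that one sequence of bounds serves all intervals [[a, b]]. *)
Definition is_cutoff (M : nat -> R) (a b : R) (chi : R -> R) : Prop :=
  smooth chi /\
  (forall x, a <= x <= b -> chi x = 1) /\
  (forall x, x <= a - 1 \/ b + 1 <= x -> chi x = 0) /\
  (forall k x, Rabs (Derive_n chi k x) <= M k).

Lemma exists_smooth_cutoff : exists M : nat -> R, forall a b, a <= b ->
  exists chi : R -> R, is_cutoff M a b chi.
Proof.
  destruct exists_smooth_step as (St & HS & Sl & Sr & SM).
  set (M := fun k => proj1_sig (constructive_indefinite_description _ (SM k))).
  assert (HM : forall k x, Rabs (Derive_n St k x) <= M k).
  { intros k. exact (proj2_sig (constructive_indefinite_description _ (SM k))). }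
  exists (fun k => M k + M k). intros a b Hab.
  (* One step rises on [[a - 1, a]], the other is subtracted on [[b, b + 1]]. Being translates of a
     fixed function, they have derivative bounds independent of [a] and [b]. *)
  exists (fun x => St (1 * x + (1 - a)) + (-1) * St (1 * x + - b)).
  pose proof (smooth_affine St 1 (1 - a) HS). pose proof (smooth_affine St 1 (- b) HS).
  pose proof (smooth_mult _ _ (smooth_const (-1)) H0).
  split; [|split; [|split]].
  - now apply smooth_plus.
  - intros x Hx. rewrite Sr, Sl by lra. ring.
  - intros x [Hx|Hx]; [rewrite !Sl by lra | rewrite !Sr by lra]; ring.
  - intros k x. rewrite Derive_n_plus_smooth by assumption.
    rewrite Derive_n_scal_l, !Derive_n_affine by assumption. rewrite pow1, !Rmult_1_l.
    eapply Rle_trans; [apply Rabs_triang|]. apply Rplus_le_compat; [apply HM|].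
    rewrite Rabs_mult, Rabs_m1, Rmult_1_l. apply HM.
Qed.

(** * The heat kernel *)

Lemma sqrt_4PI_pos t : 0 < t -> 0 < sqrt (4 * PI * t).
Proof. intros Ht. apply sqrt_lt_R0. assert (H := PI_RGT_0). apply Rmult_lt_0_compat; lra. Qed.

Lemma Theta_pos t x : 0 < t -> 0 < Theta t x.
Proof.
  intros Ht. apply Rmult_lt_0_compat; [|apply exp_pos].
  now apply Rinv_0_lt_compat, sqrt_4PI_pos.
Qed.

Lemma is_derive_Theta t x : 0 < t ->
  is_derive (Theta t) x (- / (2 * t) * x * Theta t x).
Proof.
  intros Ht. unfold Theta. auto_derive; [exact I|].
  unfold Rdiv. replace (x * (x * 1)) with (x ^ 2) by ring.
  assert (H := sqrt_4PI_pos t Ht). field. lra.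
Qed.

Lemma smooth_Theta t : 0 < t -> smooth (Theta t).
Proof.
  intros Ht. apply smooth_linear_ode with (fun x => - / (2 * t) * x).
  - intros x. now apply is_derive_Theta.
  - apply smooth_mult; [apply smooth_const | apply smooth_id].
Qed.

Lemma Derive_Theta t : 0 < t ->
  Derive (Theta t) = (fun x => - / (2 * t) * (x * Theta t x)).
Proof.
  intros Ht. apply functional_extensionality. intros x. rewrite <- Rmult_assoc.
  now apply is_derive_unique, is_derive_Theta.
Qed.

Lemma Derive_id_mult f : (forall x, ex_derive f x) ->
  Derive (fun y => y * f y) = (fun y => f y + y * Derive f y).
Proof.
  intros Hf. apply functional_extensionality. intros y.
  rewrite Derive_mult; [rewrite Derive_id; ring | apply ex_derive_id | apply Hf].
Qed.

Lemma Derive_n_id_mult f k x : smooth f ->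
  Derive_n (fun y => y * f y) (S k) x
  = x * Derive_n f (S k) x + INR (S k) * Derive_n f k x.
Proof.
  revert f. induction k as [|k IH]; intros f Hf;
    rewrite <- Derive_n_Derive, Derive_id_mult by (intros y; now apply smooth_ex_derive).
  - change (Derive_n f 1 x) with (Derive f x). simpl. ring.
  - pose proof (smooth_Derive _ Hf).
    rewrite (Derive_n_plus_smooth f (fun y => y * Derive f y) _ _ Hf)
      by (apply smooth_mult; [apply smooth_id | assumption]).
    rewrite IH, !Derive_n_Derive by assumption.
    rewrite (S_INR (S k)). ring.
Qed.

(** The Hermite recurrence: differentiate [Theta' = - x / (2 t) * Theta]. As [x] is linear, only two
    Leibniz terms survive. *)
Lemma Derive_n_Theta_rec t k x : 0 < t ->
  Derive_n (Theta t) (S (S k)) x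
  = - / (2 * t) * (x * Derive_n (Theta t) (S k) x + INR (S k) * Derive_n (Theta t) k x).
Proof.
  intros Ht. rewrite <- Derive_n_Derive, Derive_Theta by assumption.
  rewrite Derive_n_scal_l, Derive_n_id_mult; [reflexivity | now apply smooth_Theta].
Qed.

Lemma Theta_le_pow t x m : 0 < t -> x <> 0 ->
  Theta t x <= / sqrt (4 * PI * t) * (INR (fact m) * 4 ^ m) * (t / x ^ 2) ^ m.
Proof.
  intros Ht Hx. assert (Hq := sqrt_4PI_pos t Ht).
  assert (Hx2 : 0 < x ^ 2) by now apply pow2_gt_0.
  unfold Theta. rewrite (Rmult_assoc (/ _)). apply Rmult_le_compat_l.
  { now apply Rlt_le, Rinv_0_lt_compat. }
  replace (- x ^ 2 / (4 * t)) with (- (x ^ 2 / (4 * t))) by (field; lra).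
  eapply Rle_trans; [apply (exp_neg_le_pow m); apply Rdiv_lt_0_compat; lra|].
  right. rewrite Rmult_assoc, <- Rpow_mult_distr. do 2 f_equal. field. lra.
Qed.

(* The factor 1/t produced by each differentiation is absorbed by raising m,
   so no power of 1/t survives. *)
Lemma Derive_n_Theta_bound T k m : 0 < T -> exists C, 0 <= C /\
  forall t x, 0 < t <= T -> 1 <= Rabs x ->
    Rabs (Derive_n (Theta t) k x) <= C * (t / x ^ 2) ^ m.
Proof.
  intros HT.
  assert (Hx1 : forall x, 1 <= Rabs x -> 1 <= x ^ 2).
  { intros x Hx. rewrite <- pow2_abs. nra. }
  assert (Hr : forall t x, 0 < t <= T -> 1 <= Rabs x -> 0 < t / x ^ 2).
  { intros t x Ht Hx. apply Rdiv_lt_0_compat; [lra|]. specialize (Hx1 x Hx). lra. }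
  assert (Hmul : forall C t x m0 v, 0 < t <= T -> 1 <= Rabs x ->
    Rabs v <= C * (t / x ^ 2) ^ S m0 ->
    Rabs (/ (2 * t) * (x * v)) <= C * (t / x ^ 2) ^ m0 /\
    Rabs (/ (2 * t) * v) <= C * (t / x ^ 2) ^ m0).
  { intros C t x m0 v Ht Hx Hv. specialize (Hx1 x Hx). specialize (Hr t x Ht Hx).
    assert (Hm : 0 < (t / x ^ 2) ^ m0) by now apply pow_lt.
    assert (Hti : 0 < / (2 * t)) by (apply Rinv_0_lt_compat; lra).
    assert (Hv0 := Rabs_pos v).
    simpl in Hv. set (p := (t / (x * (x * 1))) ^ m0) in *.
    change ((t / x ^ 2) ^ m0) with p in *.
    assert (Hxn : x <> 0) by (intros ->; simpl in Hx1; lra).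
    assert (E : Rabs x * Rabs x * Rabs v <= C * p * t).
    { replace (Rabs x * Rabs x) with (x ^ 2) by (rewrite <- pow2_abs; ring).
      replace (C * p * t) with (x ^ 2 * (C * (t / (x * (x * 1)) * p))) by (field; exact Hxn).
      apply Rmult_le_compat_l; lra. }
    rewrite !Rabs_mult, (Rabs_pos_eq (/ _)) by lra.
    assert (F : forall w, w <= C * p * t -> 0 <= w -> / (2 * t) * w <= C * p).
    { intros w Hw Hw0. apply (Rmult_le_reg_l (2 * t)); [lra|].
      replace (2 * t * (/ (2 * t) * w)) with w by (field; lra). nra. }
    assert (0 <= Rabs x * Rabs v) by (apply Rmult_le_pos; lra).
    assert (Rabs v <= Rabs x * Rabs v) by nra.
    assert (Rabs x * Rabs v <= Rabs x * Rabs x * Rabs v) by (rewrite Rmult_assoc; nra).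
    split; apply F; lra. }
  assert (H0 : forall m, exists C, 0 <= C /\ forall t x, 0 < t <= T -> 1 <= Rabs x ->
    Rabs (Theta t x) <= C * (t / x ^ 2) ^ m).
  (* One of the [S m0] powers of [t / x^2] is spent on the prefactor: [t / x^2 <= t] as [x^2 >= 1],
     and [t / sqrt (4 PI t)] is at most [sqrt (4 PI t)]. *)
  { intros m0. exists (sqrt (4 * PI * T) * (INR (fact (S m0)) * 4 ^ S m0)). split.
    { apply Rmult_le_pos; [apply sqrt_pos|]. apply Rmult_le_pos; [apply pos_INR|].
      apply pow_le. lra. }
    intros t x Ht Hx. specialize (Hx1 x Hx). specialize (Hr t x Ht Hx).
    assert (Hq := sqrt_4PI_pos t (proj1 Ht)).
    assert (Hm : 0 < (t / x ^ 2) ^ m0) by now apply pow_lt.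
    rewrite Rabs_pos_eq by (apply Rlt_le, Theta_pos; lra).
    eapply Rle_trans; [apply (Theta_le_pow t x (S m0)); [lra | nra]|].
    assert (Hc : 0 <= INR (fact (S m0)) * 4 ^ S m0).
    { apply Rmult_le_pos; [apply pos_INR | apply pow_le; lra]. }
    set (c := INR (fact (S m0)) * 4 ^ S m0) in *.
    rewrite <- (tech_pow_Rmult _ m0).
    replace (/ sqrt (4 * PI * t) * c * (t / x ^ 2 * (t / x ^ 2) ^ m0))
      with ((/ sqrt (4 * PI * t) * (t / x ^ 2)) * c * (t / x ^ 2) ^ m0) by ring.
    apply Rmult_le_compat_r; [lra|]. apply Rmult_le_compat_r; [lra|].
    apply Rle_trans with (sqrt (4 * PI * t)).
    - apply (Rmult_le_reg_l (sqrt (4 * PI * t))); [lra|].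
      rewrite <- Rmult_assoc, Rinv_r, Rmult_1_l by lra.
      assert (HP := PI2_1). rewrite sqrt_sqrt by nra.
      apply Rle_trans with t; [|nra].
      apply (Rmult_le_reg_r (x ^ 2)); [lra|].
      replace (t / x ^ 2 * x ^ 2) with t by (field; nra). nra.
    - assert (HP := PI2_1). apply sqrt_le_1_alt. nra. }
  (* Two consecutive orders are carried together because the recurrence has two steps. *)
  assert (H : forall k, (forall m, exists C, 0 <= C /\ forall t x, 0 < t <= T -> 1 <= Rabs x ->
      Rabs (Derive_n (Theta t) k x) <= C * (t / x ^ 2) ^ m) /\
    (forall m, exists C, 0 <= C /\ forall t x, 0 < t <= T -> 1 <= Rabs x ->
      Rabs (Derive_n (Theta t) (S k) x) <= C * (t / x ^ 2) ^ m)).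
  2:{ apply H. }
  clear k m. intros k. induction k as [|k [IH0 IH1]]; split.
  - exact H0.
  - intros m. destruct (H0 (S m)) as (C & HC & HB). exists C. split; [exact HC|].
    intros t x Ht Hx. change (Derive_n (Theta t) 1) with (Derive (Theta t)).
    rewrite Derive_Theta by lra.
    rewrite Ropp_mult_distr_l_reverse, Rabs_Ropp.
    exact (proj1 (Hmul C t x m _ Ht Hx (HB t x Ht Hx))).
  - exact IH1.
  - intros m. destruct (IH1 (S m)) as (C1 & HC1 & HB1).
    destruct (IH0 (S m)) as (C0 & HC0 & HB0).
    exists (C1 + INR (S k) * C0). split.
    { apply Rplus_le_le_0_compat; [exact HC1|]. apply Rmult_le_pos; [apply pos_INR | exact HC0]. }
    intros t x Ht Hx. rewrite Derive_n_Theta_rec by lra.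
    rewrite Ropp_mult_distr_l_reverse, Rabs_Ropp, Rmult_plus_distr_l.
    eapply Rle_trans; [apply Rabs_triang|]. rewrite Rmult_plus_distr_r.
    apply Rplus_le_compat.
    + exact (proj1 (Hmul C1 t x m _ Ht Hx (HB1 t x Ht Hx))).
    + rewrite (Rmult_comm (INR (S k)) (Derive_n _ _ _)), <- Rmult_assoc, Rabs_mult.
      rewrite (Rabs_pos_eq (INR _)) by apply pos_INR.
      replace (INR (S k) * C0 * (t / x ^ 2) ^ m) with (C0 * (t / x ^ 2) ^ m * INR (S k)) by ring.
      apply Rmult_le_compat_r; [apply pos_INR|]. exact (proj2 (Hmul C0 t x m _ Ht Hx (HB0 t x Ht Hx))).
Qed.

Lemma is_derive_Theta_time t x : 0 < t ->
  is_derive (fun s => Theta s x) t ((x ^ 2 / (4 * t ^ 2) - / (2 * t)) * Theta t x).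
Proof.
  intros Ht. assert (Hq := sqrt_4PI_pos t Ht). assert (HP := PI_RGT_0).
  assert (Hs : sqrt (4 * PI * t) * sqrt (4 * PI * t) = 4 * PI * t) by (apply sqrt_sqrt; nra).
  unfold Theta. auto_derive.
  { repeat split; try lra. nra. }
  replace (- (x * (x * 1)) * / (4 * t)) with (- x ^ 2 / (4 * t)) by (field; lra).
  set (q := sqrt (4 * PI * t)) in *.
  replace (4 * PI * 1 * / (2 * q)) with (q / (2 * t)).
  2:{ apply (Rmult_eq_reg_r (2 * t * q)); [|nra].
      replace (q / (2 * t) * (2 * t * q)) with (q * q) by (field; lra). rewrite Hs. field. lra. }
  field. lra.
Qed.

(** The right-hand side is the time derivative found in [is_derive_Theta_time]; the two lemmas
    together are the heat equation for the kernel. *)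
Lemma heat_equation_Theta t x : 0 < t ->
  Derive_n (Theta t) 2 x = (x ^ 2 / (4 * t ^ 2) - / (2 * t)) * Theta t x.
Proof.
  intros Ht. rewrite Derive_n_Theta_rec by assumption.
  change (Derive_n (Theta t) 1 x) with (Derive (Theta t) x). rewrite Derive_Theta by assumption.
  simpl Derive_n. simpl INR. field. lra.
Qed.

Lemma continuity_2d_Theta (f g : R -> R -> R) x y :
  continuity_2d_pt f x y -> continuity_2d_pt g x y -> 0 < f x y ->
  continuity_2d_pt (fun u v => Theta (f u v) (g u v)) x y.
Proof.
  intros Hf Hg Hp. unfold Theta, Rdiv.
  assert (HP := PI_RGT_0).
  assert (H4 : forall c, continuity_2d_pt (fun u v => c * f u v) x y).
  { intros c. apply continuity_2d_pt_mult; [apply continuity_2d_pt_const | exact Hf]. }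
  apply continuity_2d_pt_mult.
  - apply continuity_2d_pt_inv.
    + apply (continuity_1d_2d_pt_comp sqrt (fun u v => 4 * PI * f u v)); [|apply H4].
      apply continuity_pt_sqrt. nra.
    + apply Rgt_not_eq, sqrt_4PI_pos, Hp.
  - apply (continuity_1d_2d_pt_comp exp (fun u v => - (g u v ^ 2) * / (4 * f u v))).
    { apply derivable_continuous_pt, derivable_pt_exp. }
    apply continuity_2d_pt_mult.
    + apply continuity_2d_pt_opp. simpl.
      repeat apply continuity_2d_pt_mult; auto. apply continuity_2d_pt_const.
    + apply continuity_2d_pt_inv; [apply H4 | lra].
Qed.

(** * The heat kernel is an approximate identity *)

(** This is [sqrt PI / 2] times the error function. *)
Definition gauss (x : R) : R := RInt (fun s => exp (- s ^ 2)) 0 x.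

Lemma continuous_gauss_density x : continuous (fun s => exp (- s ^ 2)) x.
Proof. apply (@ex_derive_continuous R_AbsRing R_NormedModule). auto_derive. exact I. Qed.

Lemma ex_RInt_gauss a b : ex_RInt (fun s => exp (- s ^ 2)) a b.
Proof.
  apply (ex_RInt_continuous (V := R_CompleteNormedModule)).
  intros z _. apply continuous_gauss_density.
Qed.

Lemma is_derive_gauss x : is_derive gauss x (exp (- x ^ 2)).
Proof.
  apply (is_derive_RInt (fun s => exp (- s ^ 2)) gauss 0 x).
  - apply filter_forall. intros y. apply (RInt_correct (V := R_CompleteNormedModule)).
    apply ex_RInt_gauss.
  - apply continuous_gauss_density.
Qed.

Lemma gauss_nonneg x : 0 <= x -> 0 <= gauss x.
Proof.
  intros Hx. apply RInt_ge_0; [exact Hx | apply ex_RInt_gauss |].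
  intros s _. apply Rlt_le, exp_pos.
Qed.

Lemma is_derive_zero_const f a b : (forall x, is_derive f x 0) -> f a = f b.
Proof.
  intros H. destruct (MVT_gen f a b (fun _ => 0)) as (c & _ & Hc).
  - intros x _. apply H.
  - intros x _. apply continuity_pt_filterlim.
    apply (@ex_derive_continuous R_AbsRing R_NormedModule). now exists 0.
  - lra.
Qed.

Lemma gauss_opp x : gauss (- x) = - gauss x.
Proof.
  assert (H : gauss x + gauss (- x) = gauss 0 + gauss (- 0)).
  { apply (is_derive_zero_const (fun y => gauss y + gauss (- y))). intros y.
    evar_last.
    - apply @is_derive_plus; [apply is_derive_gauss|].
      apply (is_derive_comp gauss (fun y => - y)); [apply is_derive_gauss|].
      apply (is_derive_opp (fun y : R => y)), is_derive_id.
    - unfold plus, scal, opp, one; simpl. unfold mult; simpl.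
      replace (- y * (- y * 1)) with (y * (y * 1)) by ring. ring. }
  rewrite Ropp_0 in H. unfold gauss in H at 3 4. rewrite RInt_point in H.
  unfold zero in H; simpl in H. lra.
Qed.

(* Differentiating under the integral sign shows that gauss x ^ 2 plus the
   integral of exp(- x^2 (1 + s^2)) / (1 + s^2) over [0, 1] is constant,
   hence equal to its value atan 1 at x = 0. *)
Lemma gauss_sq_bounds x : PI / 4 - exp (- x ^ 2) <= gauss x ^ 2 <= PI / 4.
Proof.
  set (k := fun x s : R => exp (- x ^ 2 * (1 + s ^ 2)) / (1 + s ^ 2)).
  assert (Hs : forall s, 1 <= 1 + s ^ 2) by (intros s; assert (H := pow2_ge_0 s); lra).
  assert (Dk : forall x s, is_derive (fun z => k z s) x (- 2 * x * exp (- x ^ 2 * (1 + s ^ 2)))).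
  { intros y s. unfold k. specialize (Hs s). auto_derive; [simpl in *; lra|].
    simpl in *. field. lra. }
  assert (Ck' : forall x s, continuous (k x) s).
  { intros y s. apply (@ex_derive_continuous R_AbsRing R_NormedModule).
    unfold k. specialize (Hs s). auto_derive. simpl in *. lra. }
  assert (Ik : forall x, ex_RInt (k x) 0 1).
  { intros y. apply (ex_RInt_continuous (V := R_CompleteNormedModule)). intros; apply Ck'. }
  assert (DH : forall x, is_derive (fun x => RInt (k x) 0 1) x (- 2 * exp (- x ^ 2) * gauss x)).
  { intros y. evar_last.
    - apply is_derive_RInt_param.
      + apply filter_forall. intros z s _. eexists. apply Dk.
      + intros s _.
        apply continuity_2d_pt_ext with (fun u v => - 2 * u * exp (- (u * u) * (1 + v * v))).
        { intros u v. symmetry. eapply eq_trans; [apply (is_derive_unique _ _ _ (Dk u v))|].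
          f_equal. f_equal. ring. }
        apply continuity_2d_pt_mult.
        { apply continuity_2d_pt_mult; [apply continuity_2d_pt_const | apply continuity_2d_pt_id1]. }
        apply (continuity_1d_2d_pt_comp exp (fun u v => - (u * u) * (1 + v * v))).
        { apply derivable_continuous_pt, derivable_pt_exp. }
        apply continuity_2d_pt_mult.
        * apply continuity_2d_pt_opp. apply continuity_2d_pt_mult; apply continuity_2d_pt_id1.
        * apply continuity_2d_pt_plus; [apply continuity_2d_pt_const|].
          apply continuity_2d_pt_mult; apply continuity_2d_pt_id2.
      + apply filter_forall. intros z. apply Ik.
    (* The factor [y] is kept inside and [+ 0] is added to match the affine substitution
       [y * s + 0], which turns the integral over [[0, 1]] into [gauss y]. *)
    - rewrite (RInt_ext _ (fun s => scal (- 2 * exp (- y ^ 2)) (y * exp (- (y * s + 0) ^ 2)))).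
      2:{ intros s _. eapply eq_trans; [apply (is_derive_unique _ _ _ (Dk y s))|].
          replace (- y ^ 2 * (1 + s ^ 2)) with (- y ^ 2 + - (y * s + 0) ^ 2) by ring.
          rewrite exp_plus. unfold scal; simpl; unfold mult; simpl. ring. }
      eapply eq_trans; [apply (RInt_scal (V := R_CompleteNormedModule) (fun s => y * exp (- (y * s + 0) ^ 2)))|].
      2:{ unfold scal; simpl; unfold mult; simpl. f_equal.
        eapply eq_trans; [apply (RInt_comp_lin (fun s => exp (- s ^ 2)) y 0 0 1)|].
        - apply ex_RInt_gauss.
        - unfold gauss. f_equal; ring. }
      apply (ex_RInt_continuous (V := R_CompleteNormedModule)). intros z _.
      apply (@ex_derive_continuous R_AbsRing R_NormedModule). auto_derive. exact I. }
  assert (HC : gauss x ^ 2 + RInt (k x) 0 1 = gauss 0 ^ 2 + RInt (k 0) 0 1).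
  { apply (is_derive_zero_const (fun y => gauss y ^ 2 + RInt (k y) 0 1)). intros y.
    evar_last.
    - apply @is_derive_plus; [|apply DH].
      apply (is_derive_pow gauss 2 y _ (is_derive_gauss y)).
    - unfold plus; simpl. ring. }
  assert (H1 : RInt (k 0) 0 1 = PI / 4).
  { rewrite <- atan_1. apply is_RInt_unique. evar_last.
    - apply (is_RInt_derive atan (k 0)); [|intros; apply Ck'].
      intros z _. evar_last; [apply is_derive_Reals, derivable_pt_lim_atan|].
      unfold k. replace (- 0 ^ 2 * (1 + z ^ 2)) with 0 by ring. rewrite exp_0.
      specialize (Hs z). unfold Rsqr. simpl in *. field. lra.
    - unfold minus, plus, opp; simpl. rewrite atan_0. ring. }
  assert (H0 : gauss 0 = 0) by (unfold gauss; rewrite RInt_point; reflexivity).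
  (* Since [1 + s^2 >= 1], the integrand is at most [exp (- x^2)]. This bounds the gap between
     [gauss x ^ 2] and [PI / 4]. *)
  assert (HL : 0 <= RInt (k x) 0 1 <= exp (- x ^ 2)).
  { split.
    - apply RInt_ge_0; [lra | apply Ik |]. intros s _. unfold k. specialize (Hs s).
      apply Rlt_le, Rdiv_lt_0_compat; [apply exp_pos | lra].
    - replace (exp (- x ^ 2)) with (RInt (fun _ => exp (- x ^ 2)) 0 1).
      2:{ rewrite RInt_const. unfold scal; simpl; unfold mult; simpl. ring. }
      apply RInt_le; [lra | apply Ik | apply ex_RInt_const |].
      intros s _. unfold k. specialize (Hs s). assert (He := exp_pos (- x ^ 2)).
      assert (Hx := pow2_ge_0 x).
      apply (Rmult_le_reg_r (1 + s ^ 2)); [lra|].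
      replace (exp (- x ^ 2 * (1 + s ^ 2)) / (1 + s ^ 2) * (1 + s ^ 2))
        with (exp (- x ^ 2 * (1 + s ^ 2))) by (field; lra).
      apply Rle_trans with (exp (- x ^ 2)); [|nra].
      apply Rnot_lt_le. intros Hc. apply exp_lt_inv in Hc. nra. }
  rewrite H0, H1 in HC. split; nra.
Qed.

(** Write [G = gauss x] and [q = sqrt PI]. From [G <= q / 2] follows
    [G * q / 2 >= G^2 >= q^2 / 4 - / x^2]; division by [q / 2] yields the constant [2 / q]. *)
Lemma gauss_bounds x : 0 < x ->
  sqrt PI / 2 - 2 / sqrt PI * / x ^ 2 <= gauss x <= sqrt PI / 2.
Proof.
  intros Hx. assert (HP := PI_RGT_0). assert (Hq := sqrt_lt_R0 PI HP).
  assert (Hs := sqrt_sqrt PI (Rlt_le _ _ HP)).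
  assert (H := gauss_sq_bounds x). assert (Hg := gauss_nonneg x (Rlt_le _ _ Hx)).
  assert (Hx2 : 0 < x ^ 2) by now apply pow_lt.
  assert (He := exp_neg_le_pow 1 (x ^ 2) Hx2). simpl INR in He. rewrite pow_1, Rmult_1_l in He.
  set (q := sqrt PI) in *. set (G := gauss x) in *. set (w := / x ^ 2) in *.
  assert (HG : G <= q / 2) by nra.
  split; [|exact HG].
  apply (Rmult_le_reg_r (q / 2)); [lra|].
  replace ((q / 2 - 2 / q * w) * (q / 2)) with (q * q / 4 - w) by (field; lra).
  nra.
Qed.

Lemma is_derive_Theta_gauss t x0 y : 0 < t ->
  is_derive (fun y => / sqrt PI * gauss ((y - x0) / sqrt (4 * t))) y (Theta t (x0 - y)).
Proof.
  intros Ht. assert (HP := PI_RGT_0). assert (Hq := sqrt_lt_R0 PI HP).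
  assert (H4 : 0 < sqrt (4 * t)) by (apply sqrt_lt_R0; lra).
  evar_last.
  - apply (is_derive_scal (fun y => gauss ((y - x0) / sqrt (4 * t))) y (/ sqrt PI)).
    apply (is_derive_comp gauss (fun y => (y - x0) / sqrt (4 * t))); [apply is_derive_gauss|].
    auto_derive; [lra | reflexivity].
  - unfold scal, mult; simpl. unfold mult; simpl. unfold Theta.
    replace (4 * PI * t) with (PI * (4 * t)) by ring.
    rewrite (sqrt_mult PI (4 * t)) by lra.
    replace (- ((y - x0) / sqrt (4 * t) * ((y - x0) / sqrt (4 * t) * 1)))
      with (- (x0 - y) ^ 2 / (4 * t)).
    + field. lra.
    + rewrite <- (sqrt_sqrt (4 * t)) at 1 by lra. field. lra.
Qed.

Lemma continuous_Theta_refl t x0 y : 0 < t -> continuous (fun y => Theta t (x0 - y)) y.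
Proof.
  intros Ht. apply (@ex_derive_continuous R_AbsRing R_NormedModule).
  apply (ex_derive_comp (Theta t) (fun y => x0 - y)).
  - eexists. now apply is_derive_Theta.
  - auto_derive. exact I.
Qed.

(** The substitution [(y - x0) / sqrt (4 t)] expresses the integral by two values of [gauss], each
    close to half the total mass. The missing mass vanishes linearly in [t] for fixed [A] and
    [B]. *)
Lemma RInt_Theta_bounds t x0 A B : 0 < t -> A < x0 < B ->
  1 - 8 * t * (/ (B - x0) ^ 2 + / (x0 - A) ^ 2) <= RInt (fun y => Theta t (x0 - y)) A B <= 1.
Proof.
  intros Ht HAB. assert (HP := PI_RGT_0). assert (Hq := sqrt_lt_R0 PI HP).
  assert (Hs := sqrt_sqrt PI (Rlt_le _ _ HP)).
  assert (H4 : 0 < sqrt (4 * t)) by (apply sqrt_lt_R0; lra).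
  assert (H4s := sqrt_sqrt (4 * t) ltac:(lra)).
  assert (E : RInt (fun y => Theta t (x0 - y)) A B
    = / sqrt PI * (gauss ((B - x0) / sqrt (4 * t)) + gauss ((x0 - A) / sqrt (4 * t)))).
  { apply is_RInt_unique. evar_last.
    - apply (is_RInt_derive (fun y => / sqrt PI * gauss ((y - x0) / sqrt (4 * t)))).
      + intros y _. now apply is_derive_Theta_gauss.
      + intros y _. now apply continuous_Theta_refl.
    - unfold minus, plus, opp; simpl.
      replace ((A - x0) / sqrt (4 * t)) with (- ((x0 - A) / sqrt (4 * t))) by (field; lra).
      rewrite gauss_opp. ring. }
  (* The computation yields [8 t / (PI d^2)]; the factor [1 / PI] is dropped. *)
  assert (Hb : forall d, 0 < d ->
    1 / 2 - 8 * t * / d ^ 2 <= / sqrt PI * gauss (d / sqrt (4 * t)) <= 1 / 2).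
  { intros d Hd. assert (Hp : 0 < d / sqrt (4 * t)) by now apply Rdiv_lt_0_compat.
    assert (H := gauss_bounds _ Hp).
    set (q := sqrt PI) in *. set (r := sqrt (4 * t)) in *. set (G := gauss (d / r)) in *.
    assert (Hd2 : 0 < / d ^ 2) by (apply Rinv_0_lt_compat, pow_lt, Hd).
    replace (2 / q * / (d / r) ^ 2) with (2 / q * (4 * t * / d ^ 2)) in H.
    2:{ rewrite <- H4s. field. lra. }
    assert (H2 := PI2_1).
    split; apply (Rmult_le_reg_l q); try lra.
    - rewrite <- (Rmult_assoc q (/ q)), Rinv_r, Rmult_1_l by lra.
      replace (q * (1 / 2 - 8 * t * / d ^ 2)) with (q / 2 - q * q * 2 / q * (4 * t * / d ^ 2)) by (field; nra).
      assert (0 < t * / d ^ 2) by nra.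
      assert (2 / q * (4 * t * / d ^ 2) <= q * q * 2 / q * (4 * t * / d ^ 2)); [|lra].
      apply Rmult_le_compat_r; [nra|]. unfold Rdiv. apply Rmult_le_compat_r; [|nra].
      now apply Rlt_le, Rinv_0_lt_compat.
    - rewrite <- (Rmult_assoc q (/ q)), Rinv_r, Rmult_1_l by lra. lra. }
  rewrite E. assert (H1 := Hb (B - x0) ltac:(lra)). assert (H2 := Hb (x0 - A) ltac:(lra)).
  lra.
Qed.

(** The case [m = 1] of [Theta_le_pow], with [4 t <= 4 PI t]. It makes quadratic errors negligible
    against the kernel, uniformly in [x]. *)
Lemma sq_Theta_le t x : 0 < t -> x ^ 2 * Theta t x <= sqrt (4 * PI * t).
Proof.
  intros Ht. assert (Hq := sqrt_4PI_pos t Ht). assert (H2 := PI2_1).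
  assert (Hs := sqrt_sqrt (4 * PI * t) ltac:(nra)).
  destruct (Req_dec x 0) as [->|Hx]; [lra|].
  assert (Hx2 : 0 < x ^ 2) by now apply pow2_gt_0.
  assert (H := Theta_le_pow t x 1 Ht Hx). simpl fact in H. simpl INR in H.
  rewrite !pow_1, Rmult_1_l in H.
  apply Rle_trans with (x ^ 2 * (/ sqrt (4 * PI * t) * 4 * (t / x ^ 2))).
  { apply Rmult_le_compat_l; lra. }
  set (q := sqrt (4 * PI * t)) in *.
  replace (x ^ 2 * (/ q * 4 * (t / x ^ 2))) with (4 * t / q) by (field; nra).
  apply (Rmult_le_reg_r q); [lra|].
  replace (4 * t / q * q) with (4 * t) by (field; lra). nra.
Qed.

Lemma is_lim_sqrt_linear_0 K eps : 0 <= K -> 0 < eps ->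
  exists eta, 0 < eta /\ forall t, 0 < t < eta -> K * sqrt (4 * PI * t) < eps /\ K * t < eps.
Proof.
  intros HK Heps. assert (HP := PI2_1).
  (* [K + 1] rather than [K], since [K] may be 0. *)
  set (d := eps / (K + 1)). assert (Hd : 0 < d) by (apply Rdiv_lt_0_compat; lra).
  assert (Ed : d * (K + 1) = eps) by (unfold d; field; lra).
  assert (H4 : 0 < 4 * PI) by lra.
  assert (Hdd : 0 < d * d / (4 * PI)) by (apply Rdiv_lt_0_compat; nra).
  exists (Rmin d (d * d / (4 * PI))). split; [now apply Rmin_pos|].
  intros t [Ht Htm].
  assert (H1 := Rlt_le_trans _ _ _ Htm (Rmin_l _ _)).
  assert (H2 := Rlt_le_trans _ _ _ Htm (Rmin_r _ _)).
  assert (sqrt (4 * PI * t) < d).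
  { rewrite <- (sqrt_square d) by lra. apply sqrt_lt_1_alt. split; [nra|].
    apply (Rmult_lt_compat_l (4 * PI)) in H2; [|lra].
    replace (4 * PI * (d * d / (4 * PI))) with (d * d) in H2 by (field; lra). exact H2. }
  split; nra.
Qed.

Lemma Theta_approx_identity (h : R -> R) x0 A B : A < x0 < B -> (forall x, continuous h x) ->
  forall eps, 0 < eps -> exists eta, 0 < eta /\ forall t, 0 < t < eta ->
    Rabs (RInt (fun y => h y * Theta t (x0 - y)) A B - h x0) < eps.
Proof.
  intros HAB Hh eps Heps.
  destruct (bounded_continuity (V := R_NormedModule) h A B) as [M HM].
  { intros x _. apply Hh. }
  assert (HM0 : Rabs (h x0) < M) by (apply HM; lra).
  assert (Hh0 := Rabs_pos (h x0)).
  assert (Heps4 : 0 < eps / 4) by lra.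
  destruct (proj1 (filterlim_locally _ _) (Hh x0) (mkposreal _ Heps4)) as [d Hd].
  assert (Hdp := cond_pos d).
  set (K1 := 2 * M / d ^ 2).
  assert (Hd2 : 0 < d ^ 2) by now apply pow_lt.
  assert (HK1 : 0 <= K1) by (apply Rlt_le, Rdiv_lt_0_compat; lra).
  (* Near [x0] continuity gives [eps / 4]; at distance at least [d] the crude bound [2 M] is at most
     [K1 (x0 - y)^2]. One inequality thus covers both regions, and [sq_Theta_le] disposes of the
     quadratic term. *)
  assert (Hdom : forall y, A <= y <= B -> Rabs (h y - h x0) <= eps / 4 + K1 * (x0 - y) ^ 2).
  { intros y Hy. assert (Hsq := pow2_ge_0 (x0 - y)).
    destruct (Rlt_dec (Rabs (y - x0)) d) as [Hl|Hl].
    - assert (H := Hd y Hl). unfold ball in H; simpl in H. unfold AbsRing_ball, abs, minus, plus, opp in H; simpl in H.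
      apply Rlt_le in H. unfold Rminus. nra.
    - assert (Hy' : Rabs (h y) < M) by now apply HM.
      assert (Hy2 : d ^ 2 <= (x0 - y) ^ 2).
      { rewrite <- (pow2_abs (x0 - y)), Rabs_minus_sym. apply pow_incr. lra. }
      apply Rle_trans with (2 * M).
      + eapply Rle_trans; [apply Rabs_triang|]. rewrite Rabs_Ropp. lra.
      + replace (2 * M) with (K1 * d ^ 2) by (unfold K1; field; lra). nra. }
  set (K2 := 8 * (/ (B - x0) ^ 2 + / (x0 - A) ^ 2)).
  assert (HK2 : 0 <= K2).
  { apply Rmult_le_pos; [lra|].
    apply Rplus_le_le_0_compat; apply Rlt_le, Rinv_0_lt_compat, pow_lt; lra. }
  destruct (is_lim_sqrt_linear_0 (K1 * (B - A)) (eps / 4)) as (e1 & He1 & H1); [nra|lra|].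
  destruct (is_lim_sqrt_linear_0 (K2 * Rabs (h x0)) (eps / 4)) as (e2 & He2 & H2); [nra|lra|].
  exists (Rmin e1 e2). split; [now apply Rmin_pos|].
  intros t [Ht Htm].
  destruct (H1 t) as [H1' _]; [split; [lra | eapply Rlt_le_trans; [apply Htm | apply Rmin_l]]|].
  destruct (H2 t) as [_ H2']; [split; [lra | eapply Rlt_le_trans; [apply Htm | apply Rmin_r]]|].
  assert (HI := RInt_Theta_bounds t x0 A B Ht HAB).
  assert (HK2e : 1 - K2 * t <= RInt (fun y => Theta t (x0 - y)) A B).
  { eapply Rle_trans; [|apply HI]. right. unfold K2. ring. }
  assert (Cont : forall f : R -> R, (forall y, continuous f y) -> ex_RInt f A B).
  { intros f Hf. apply (ex_RInt_continuous (V := R_CompleteNormedModule)). auto. }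
  assert (CT : forall y, continuous (fun y => Theta t (x0 - y)) y)
    by (intros; now apply continuous_Theta_refl).
  assert (CD : forall y, continuous (fun y => h y - h x0) y).
  { intros y. apply (continuous_minus (V := R_NormedModule) h); [apply Hh | apply continuous_const]. }
  assert (CDT : forall y, continuous (fun y => (h y - h x0) * Theta t (x0 - y)) y).
  { intros y. apply (continuous_mult (fun y => h y - h x0)); auto. }
  set (I := RInt (fun y => Theta t (x0 - y)) A B) in *.
  (* Separates the oscillation of [h] around [x0] from the mass defect [1 - I], which is multiplied
     by [h x0]. *)
  assert (E : RInt (fun y => h y * Theta t (x0 - y)) A B
    = RInt (fun y => (h y - h x0) * Theta t (x0 - y)) A B + h x0 * I).
  { unfold I. rewrite <- (RInt_scal (V := R_CompleteNormedModule)) by auto.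
    rewrite <- (RInt_plus (V := R_CompleteNormedModule)); auto.
    - apply RInt_ext. intros y _. unfold plus, scal; simpl. unfold mult; simpl. ring.
    - apply Cont. intros y. apply (continuous_scal_r (V := R_NormedModule) (h x0)). apply CT. }
  rewrite E.
  assert (HD : Rabs (RInt (fun y => (h y - h x0) * Theta t (x0 - y)) A B)
    <= eps / 4 * I + K1 * (B - A) * sqrt (4 * PI * t)).
  { eapply Rle_trans; [apply abs_RInt_le; [lra | auto]|].
    apply Rle_trans with (RInt (fun y => eps / 4 * Theta t (x0 - y) + K1 * sqrt (4 * PI * t)) A B).
    - apply RInt_le; [lra| | |].
      + apply Cont. intros y. apply (continuous_comp _ Rabs); [apply CDT | apply continuous_Rabs].
      + apply Cont. intros y. apply (continuous_plus (V := R_NormedModule)); [|apply continuous_const].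
        apply (continuous_scal_r (V := R_NormedModule) (eps / 4)). apply CT.
      + intros y Hy. assert (HT := Theta_pos t (x0 - y) Ht).
        rewrite Rabs_mult, (Rabs_pos_eq (Theta _ _)) by lra.
        assert (Hq := sq_Theta_le t (x0 - y) Ht).
        apply Rle_trans with ((eps / 4 + K1 * (x0 - y) ^ 2) * Theta t (x0 - y)).
        * apply Rmult_le_compat_r; [lra|]. apply Hdom. lra.
        * nra.
    - right. rewrite (RInt_plus (V := R_CompleteNormedModule)).
      + rewrite (RInt_scal (V := R_CompleteNormedModule)) by auto. rewrite RInt_const.
        unfold plus, scal; simpl. unfold mult; simpl. fold I. ring.
      + apply Cont. intros y. apply (continuous_scal_r (V := R_NormedModule) (eps / 4)). apply CT.
      + apply ex_RInt_const. }
  replace (RInt (fun y => (h y - h x0) * Theta t (x0 - y)) A B + h x0 * I - h x0)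
    with (RInt (fun y => (h y - h x0) * Theta t (x0 - y)) A B + - (h x0 * (1 - I))) by ring.
  eapply Rle_lt_trans; [apply Rabs_triang|]. rewrite Rabs_Ropp, Rabs_mult, (Rabs_pos_eq (1 - I)) by lra.
  nra.
Qed.

(** * The primitives in B_c *)

Lemma in_Bc_bounded G : in_Bc G -> exists M, forall x, Rabs (G x) <= M.
Proof.
  intros (Hc & Hm & [l Hp]).
  apply is_lim_spec in Hm. apply is_lim_spec in Hp.
  destruct (Hm (mkposreal 1 Rlt_0_1)) as [A HA]. destruct (Hp (mkposreal 1 Rlt_0_1)) as [B HB].
  simpl in HA, HB.
  destruct (bounded_continuity (V := R_NormedModule) G A B) as [M HM].
  { intros x _. apply Hc. }
  exists (Rmax (Rmax 1 M) (Rabs l + 1)). intros x.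
  destruct (Rlt_dec x A) as [H|H]; [|destruct (Rlt_dec B x) as [H'|H']].
  - eapply Rle_trans; [|apply Rmax_l]. eapply Rle_trans; [|apply Rmax_l].
    specialize (HA x H). rewrite Rminus_0_r in HA. lra.
  - eapply Rle_trans; [|apply Rmax_r]. specialize (HB x H').
    replace (G x) with ((G x - l) + l) by ring. eapply Rle_trans; [apply Rabs_triang|]. lra.
  - eapply Rle_trans; [|apply Rmax_l]. eapply Rle_trans; [|apply Rmax_r].
    apply Rlt_le, (HM x). lra.
Qed.

Lemma in_Bc_minus F G : in_Bc F -> in_Bc G -> in_Bc (fun x => F x - G x).
Proof.
  intros (HcF & HmF & [lF HpF]) (HcG & HmG & [lG HpG]). split; [|split].
  - intros x. apply (continuous_minus (V := R_NormedModule) F G); auto.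
  - replace (Finite 0) with (Finite (0 - 0)) by (f_equal; ring). now apply is_lim_minus'.
  - exists (lF - lG). now apply is_lim_minus'.
Qed.

(** [G] vanishes at [-oo], so comparing [G x] with values far to the left bounds it by the
    oscillation. The norm hypotheses thereby become uniform bounds on primitives. *)
Lemma Rabs_le_Anorm G x : in_Bc G -> Rabs (G x) <= Anorm G.
Proof.
  intros HG. destruct (in_Bc_bounded G HG) as [M HM].
  assert (Hosc : forall y z, y < z -> Rabs (G y - G z) <= Anorm G).
  { intros y z Hyz. unfold Anorm.
    set (E := fun r => exists x y, x < y /\ r = Rabs (G x - G y)).
    assert (HE : E (Rabs (G y - G z))) by (exists y, z; auto).
    destruct (Lub_Rbar_correct E) as [Hub Hlub].
    specialize (Hub _ HE). specialize (Hlub (Finite (M + M))).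
    (* Finiteness of the supremum must be known: [real] sends [p_infty] to 0. *)
    assert (Hb : is_ub_Rbar E (M + M)).
    { intros r (v & w & _ & ->). simpl. unfold Rminus.
      eapply Rle_trans; [apply Rabs_triang|]. rewrite Rabs_Ropp. now apply Rplus_le_compat. }
    specialize (Hlub Hb). destruct (Lub_Rbar E); simpl in *; easy. }
  destruct HG as (_ & Hm & _). apply is_lim_spec in Hm.
  apply le_epsilon. intros eps Heps.
  destruct (Hm (mkposreal eps Heps)) as [A HA]. simpl in HA.
  set (y := Rmin A x - 1).
  assert (Hy1 : y < A) by (assert (H := Rmin_l A x); unfold y; lra).
  assert (Hy2 : y < x) by (assert (H := Rmin_r A x); unfold y; lra).
  specialize (HA y Hy1). rewrite Rminus_0_r in HA. specialize (Hosc y x Hy2).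
  rewrite Rabs_minus_sym in Hosc.
  replace (G x) with ((G x - G y) + G y) by ring.
  eapply Rle_trans; [apply Rabs_triang|]. lra.
Qed.

(** * The kernel with a cutoff *)

Lemma smooth_kernel t x0 : 0 < t -> smooth (fun y => Theta t (x0 - y)).
Proof.
  intros Ht. replace (fun y => Theta t (x0 - y)) with (fun y => Theta t ((-1) * y + x0)).
  - now apply smooth_affine, smooth_Theta.
  - apply functional_extensionality. intros y. f_equal. ring.
Qed.

Lemma Derive_n_kernel t x0 k y : 0 < t ->
  Derive_n (fun y => Theta t (x0 - y)) k y = (-1) ^ k * Derive_n (Theta t) k (x0 - y).
Proof.
  intros Ht. replace (fun y => Theta t (x0 - y)) with (fun y => Theta t ((-1) * y + x0)).
  - rewrite Derive_n_affine by now apply smooth_Theta. f_equal. f_equal. ring.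
  - apply functional_extensionality. intros z. f_equal. ring.
Qed.

Lemma finite_upper_bound (M : nat -> R) N : exists B, forall k, (k <= N)%nat -> M k <= B.
Proof.
  induction N as [|N [B HB]].
  - exists (M O). intros k Hk. replace k with O by lia. lra.
  - exists (Rmax B (M (S N))). intros k Hk. destruct (Nat.eq_dec k (S N)) as [->|Hne].
    + apply Rmax_r.
    + eapply Rle_trans; [apply HB; lia | apply Rmax_l].
Qed.

(** The case [m = 1] of [Derive_n_Theta_bound], with [t <= T] absorbed into the constant. Staying at
    distance 1 from [x0] keeps the bound uniform as [t -> 0]. *)
Lemma Derive_n_kernel_bound T N : 0 < T -> exists C, 0 <= C /\
  forall t x0 y k, 0 < t <= T -> 1 <= Rabs (x0 - y) -> (k <= N)%nat ->
    Rabs (Derive_n (fun y => Theta t (x0 - y)) k y) <= C / (x0 - y) ^ 2.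
Proof.
  intros HT.
  set (C0 := fun k => proj1_sig
    (constructive_indefinite_description _ (Derive_n_Theta_bound T k 1 HT))).
  assert (HC0 := fun k => proj2_sig
    (constructive_indefinite_description _ (Derive_n_Theta_bound T k 1 HT))).
  change (forall k, 0 <= C0 k /\ forall t x, 0 < t <= T -> 1 <= Rabs x ->
    Rabs (Derive_n (Theta t) k x) <= C0 k * (t / x ^ 2) ^ 1) in HC0.
  destruct (finite_upper_bound C0 N) as [B HB].
  assert (HB0 : 0 <= B) by (eapply Rle_trans; [apply (HC0 O) | apply HB; lia]).
  exists (B * T). split; [nra|]. intros t x0 y k Ht Hxy Hk.
  rewrite Derive_n_kernel, Rabs_mult, pow_1_abs, Rmult_1_l by lra.
  eapply Rle_trans; [apply (HC0 k); assumption|]. rewrite pow_1.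
  assert (H2 : 0 < (x0 - y) ^ 2).
  { rewrite <- pow2_abs. apply pow_lt. lra. }
  unfold Rdiv. rewrite <- Rmult_assoc. apply Rmult_le_compat_r.
  { now apply Rlt_le, Rinv_0_lt_compat. }
  destruct (HC0 k) as [Hk0 _]. specialize (HB k Hk). nra.
Qed.

(** The orders [(i, j)] used later are [(1, 1)] and [(0, 2)], the two terms of [cutoff_defect], and
    [(0, 0)], the product of kernel and cutoff. *)
Lemma Derive_n_cutoff_kernel_bound T N M : 0 < T -> exists D, 0 <= D /\
  forall t x0 y n i j chi, 0 < t <= T -> 1 <= Rabs (x0 - y) -> (n + i <= N)%nat -> (n + j <= N)%nat ->
    smooth chi -> (forall k x, Rabs (Derive_n chi k x) <= M k) ->
    Rabs (Derive_n (fun y => Derive_n (fun y => Theta t (x0 - y)) i y * Derive_n chi j y) n y)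
      <= D / (x0 - y) ^ 2.
Proof.
  intros HT. destruct (Derive_n_kernel_bound T N HT) as (C & HC & HK).
  destruct (finite_upper_bound M N) as [B0 HB0].
  set (B := Rmax 0 B0). assert (HB := Rmax_l 0 B0 : 0 <= B).
  exists (2 ^ N * (C * B)). split.
  { apply Rmult_le_pos; [apply pow_le; lra | nra]. }
  intros t x0 y n i j chi Ht Hxy Hi Hj Hchi HM.
  pose proof (smooth_kernel t x0 (proj1 Ht)) as Hk.
  assert (H2 : 0 < / (x0 - y) ^ 2).
  { apply Rinv_0_lt_compat. rewrite <- pow2_abs. apply pow_lt. lra. }
  eapply Rle_trans; [apply (Derive_n_mult_bound _ _ y (C / (x0 - y) ^ 2) B)|].
  - now apply smooth_Derive_n.
  - now apply smooth_Derive_n.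
  - intros k Hkn. rewrite Derive_n_comp. apply HK; auto. lia.
  - intros k Hkn. rewrite Derive_n_comp. eapply Rle_trans; [apply HM|].
    eapply Rle_trans; [apply HB0; lia | apply Rmax_r].
  - unfold Rdiv.
    replace (2 ^ N * (C * B) * / (x0 - y) ^ 2) with (2 ^ N * (C * / (x0 - y) ^ 2 * B)) by ring.
    apply Rmult_le_compat_r; [|apply Rle_pow; [lra | lia]].
    apply Rmult_le_pos; [nra | exact HB].
Qed.

(** * The evolution of a solution tested against the cut-off kernel *)

Definition heat_solution (u : R -> R -> R) : Prop :=
  (forall x t, 0 < t ->
     ex_derive (fun y => u y t) x /\
     ex_derive (fun y => Derive (fun z => u z t) y) x /\
     ex_derive (fun s => u x s) t /\
     continuity_2d_pt u x t /\
     continuity_2d_pt (fun y s => Derive (fun z => u z s) y) x t /\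
     continuity_2d_pt (fun y s => Derive_n (fun z => u z s) 2 y) x t /\
     continuity_2d_pt (fun y s => Derive (fun r => u y r) s) x t) /\
  (forall x t, 0 < t ->
     Derive (fun s => u x s) t - Derive_n (fun z => u z t) 2 x = 0).

(** Differentiation under the integral expects the parameter, here time, as first variable, while
    [u] takes space first. *)
Lemma continuity_2d_pt_swap f x y :
  continuity_2d_pt f x y -> continuity_2d_pt (fun v u => f u v) y x.
Proof.
  intros H eps. destruct (H eps) as [d Hd]. exists d. intros v u Hv Hu. now apply Hd.
Qed.

Lemma continuity_2d_pt_continuous_l f x y :
  continuity_2d_pt f x y -> continuous (fun u => f u y) x.
Proof.
  intros H. apply filterlim_locally. intros eps. destruct (H eps) as [d Hd].
  exists d. intros u Hu. apply (Hd u y Hu). rewrite Rminus_diag, Rabs_R0. apply cond_pos.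
Qed.

Lemma ex_RInt_cont (f : R -> R) a b : (forall x, continuous f x) -> ex_RInt f a b.
Proof. intros H. apply (ex_RInt_continuous (V := R_CompleteNormedModule)). auto. Qed.

Lemma continuous_mult_R (f g : R -> R) x :
  continuous f x -> continuous g x -> continuous (fun y => f y * g y) x.
Proof. apply (continuous_mult (K := R_AbsRing)). Qed.

(** The strips have width 2: one unit where the cutoff varies, and one unit of margin so that it
    vanishes in a neighbourhood of the endpoints. *)
Lemma RInt_cutoff_error f a b P Q : a <= b -> (forall x, continuous f x) ->
  (forall x, a - 2 <= x <= a -> Rabs (f x) <= P) ->
  (forall x, b <= x <= b + 2 -> Rabs (f x) <= Q) ->
  Rabs (RInt f (a - 2) (b + 2) - RInt f a b) <= 2 * P + 2 * Q.
Proof.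
  intros Hab Hf HP HQ.
  assert (Hi : forall x y, ex_RInt f x y) by (intros; now apply ex_RInt_cont).
  rewrite <- (RInt_Chasles f (a - 2) a (b + 2)), <- (RInt_Chasles f a b (b + 2)) by auto.
  assert (H1 : Rabs (RInt f (a - 2) a) <= 2 * P).
  { replace 2 with (a - (a - 2)) at 2 by ring. apply abs_RInt_le_const; auto. lra. }
  assert (H2 : Rabs (RInt f b (b + 2)) <= 2 * Q).
  { replace 2 with (b + 2 - b) at 2 by ring. apply abs_RInt_le_const; auto. lra. }
  unfold plus; simpl.
  replace (RInt f (a - 2) a + (RInt f a b + RInt f b (b + 2)) - RInt f a b)
    with (RInt f (a - 2) a + RInt f b (b + 2)) by ring.
  eapply Rle_trans; [apply Rabs_triang|]. lra.
Qed.

Lemma heat_solution_Derive_n_continuous u k x t : heat_solution u -> 0 < t -> (k <= 2)%nat ->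
  continuous (Derive_n (fun y => u y t) k) x.
Proof.
  intros [Hu _] Ht Hk. destruct (Hu x t Ht) as (_ & _ & _ & H0 & H1 & H2 & _).
  destruct k as [|[|[|k]]]; [| | |lia].
  - now apply continuity_2d_pt_continuous_l in H0.
  - now apply continuity_2d_pt_continuous_l in H1.
  - now apply continuity_2d_pt_continuous_l in H2.
Qed.

(* Green's identity; the boundary terms vanish with psi. *)
Lemma Green_zero_boundary u t psi A B : heat_solution u -> 0 < t -> smooth psi ->
  psi A = 0 -> psi B = 0 -> Derive psi A = 0 -> Derive psi B = 0 ->
  is_RInt (fun y => Derive_n (fun z => u z t) 2 y * psi y - u y t * Derive_n psi 2 y) A B 0.
Proof.
  intros Hu Ht Hpsi HA HB HA' HB'.
  evar_last.
  - apply (is_RInt_derive (fun y => Derive (fun z => u z t) y * psi y - u y t * Derive psi y)).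
    + intros y _. destruct (proj1 Hu y t Ht) as (D1 & D2 & _).
      assert (P1 := smooth_ex_derive _ y Hpsi).
      assert (P2 := smooth_ex_derive _ y (smooth_Derive _ Hpsi)).
      apply Derive_correct in D1, D2, P1, P2.
      evar_last.
      * apply @is_derive_minus.
        -- apply @is_derive_mult; [exact D2 | exact P1 | exact Rmult_comm].
        -- apply @is_derive_mult; [exact D1 | exact P2 | exact Rmult_comm].
      * unfold minus, plus, opp, mult; simpl.
        change (Derive (fun x => Derive (fun z => u z t) x) y) with (Derive_n (fun z => u z t) 2 y).
        change (Derive (fun x => Derive (fun x0 => psi x0) x) y) with (Derive_n psi 2 y).
        change (Derive (Derive psi) y) with (Derive_n psi 2 y). ring.
    + intros y _. apply (continuous_minus (V := R_NormedModule)); apply continuous_mult_R.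
      * apply (heat_solution_Derive_n_continuous u 2); auto.
      * now apply (smooth_continuous psi 0).
      * apply (heat_solution_Derive_n_continuous u 0); [assumption | lra | lia].
      * now apply (smooth_continuous psi 2).
  - rewrite HA, HB, HA', HB'. unfold minus, plus, opp; simpl. ring.
Qed.

Lemma Derive_n_2_mult f g : smooth f -> smooth g -> forall y,
  Derive_n (fun y => f y * g y) 2 y
  = Derive_n f 2 y * g y + (2 * (Derive f y * Derive g y) + f y * Derive_n g 2 y).
Proof.
  intros Hf Hg y.
  assert (Hf' := smooth_Derive _ Hf). assert (Hg' := smooth_Derive _ Hg).
  rewrite <- Derive_n_Derive, Derive_mult_fun by (intros z; now apply smooth_ex_derive).
  rewrite Derive_n_plus_smooth by now apply smooth_mult.
  assert (E : forall h, Derive_n h 1 y = Derive h y) by reflexivity.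
  rewrite !E, !Derive_mult by now apply smooth_ex_derive.
  change (Derive_n f 2 y) with (Derive (Derive f) y).
  change (Derive_n g 2 y) with (Derive (Derive g) y). ring.
Qed.

(* [2 K' chi' + K chi''], the defect of [K chi] in the backward heat equation *)
Definition cutoff_defect (t x0 : R) (chi : R -> R) (y : R) : R :=
  2 * (Derive (fun y => Theta t (x0 - y)) y * Derive chi y)
  + Theta t (x0 - y) * Derive_n chi 2 y.

Lemma smooth_cutoff_defect t x0 chi : 0 < t -> smooth chi -> smooth (cutoff_defect t x0 chi).
Proof.
  intros Ht Hchi. assert (Hk := smooth_kernel t x0 Ht).
  apply smooth_plus; [apply smooth_mult; [apply smooth_const|]|]; apply smooth_mult;
    first [assumption | now apply smooth_Derive | now apply smooth_Derive_n].
Qed.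

(** By the equation, the time derivative of [u] is its second space derivative, which
    [Green_zero_boundary] moves onto kernel times cutoff. The part carrying the second derivative of
    the kernel cancels its time derivative, and only the terms with derivatives of [chi] remain. *)
Lemma is_derive_tested_solution u chi x0 S A B s : heat_solution u -> smooth chi ->
  (forall y, y <= A + 1 \/ B - 1 <= y -> chi y = 0) -> 0 < s < S ->
  is_derive (fun s => RInt (fun y => u y s * (Theta (S - s) (x0 - y) * chi y)) A B) s
    (RInt (fun y => u y s * cutoff_defect (S - s) x0 chi y) A B).
Proof.
  intros Hu Hchi Hsupp Hs.
  (* The factor in [is_derive_Theta_time] at time [S - r]; the minus sign in [D] comes from the
     reversed time. *)
  set (z2 := fun r y => (x0 - y) ^ 2 / (4 * (S - r) ^ 2) - / (2 * (S - r))).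
  set (D := fun r y => Derive (fun r => u y r) r * (Theta (S - r) (x0 - y) * chi y)
    - u y r * (z2 r y * Theta (S - r) (x0 - y) * chi y)).
  assert (HD : forall r y, 0 < r < S ->
    is_derive (fun r => u y r * (Theta (S - r) (x0 - y) * chi y)) r (D r y)).
  { intros r y Hr. destruct (proj1 Hu y r (proj1 Hr)) as (_ & _ & Dt & _).
    apply Derive_correct in Dt.
    assert (DT := is_derive_Theta_time (S - r) (x0 - y) ltac:(lra)).
    evar_last.
    - apply @is_derive_mult; [exact Dt | | exact Rmult_comm].
      apply (is_derive_ext (fun r => chi y * Theta (S - r) (x0 - y))); [intros; apply Rmult_comm|].
      apply is_derive_scal.
      apply (is_derive_comp (fun s => Theta s (x0 - y)) (fun r => S - r)); [exact DT|].
      auto_derive; [exact I | reflexivity].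
    - unfold plus, scal, mult; simpl. unfold mult; simpl. unfold D, z2. simpl. ring. }
  assert (Hloc : locally s (fun r => 0 < r < S)).
  { apply filter_and; [apply open_gt | apply open_lt]; lra. }
  evar_last.
  - apply is_derive_RInt_param.
    + apply (filter_imp (fun r => 0 < r < S)); [|exact Hloc].
      intros r Hr y _. eexists. apply HD, Hr.
    + intros y _.
      apply continuity_2d_pt_ext_loc with D.
      { destruct Hloc as [d Hd]. exists d. intros r v Hr _.
        symmetry. apply is_derive_unique, HD, Hd, Hr. }
      destruct (proj1 Hu y s (proj1 Hs)) as (_ & _ & _ & C0 & _ & _ & Ct).
      apply continuity_2d_pt_swap in C0, Ct.
      assert (CT : continuity_2d_pt (fun r v => Theta (S - r) (x0 - v)) s y).
      { apply (continuity_2d_Theta (fun r v => S - r) (fun r v => x0 - v)); [| |lra];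
          apply continuity_2d_pt_minus; try apply continuity_2d_pt_const;
          [apply continuity_2d_pt_id1 | apply continuity_2d_pt_id2]. }
      assert (Cchi : continuity_2d_pt (fun r v => chi v) s y).
      { apply (continuity_1d_2d_pt_comp chi (fun _ v => v)); [|apply continuity_2d_pt_id2].
        apply continuity_pt_filterlim. now apply (smooth_continuous chi 0). }
      assert (Cz : continuity_2d_pt z2 s y).
      { assert (CS : continuity_2d_pt (fun r _ => S - r) s y).
        { apply continuity_2d_pt_minus; [apply continuity_2d_pt_const | apply continuity_2d_pt_id1]. }
        assert (Cx : continuity_2d_pt (fun _ v => x0 - v) s y).
        { apply continuity_2d_pt_minus; [apply continuity_2d_pt_const | apply continuity_2d_pt_id2]. }
        assert (Csq : forall f, continuity_2d_pt f s y -> continuity_2d_pt (fun r v => f r v ^ 2) s y).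
        { intros f Hf. simpl. repeat apply continuity_2d_pt_mult; auto. apply continuity_2d_pt_const. }
        apply continuity_2d_pt_minus; [unfold Rdiv; apply continuity_2d_pt_mult; [now apply Csq|]|];
          (apply continuity_2d_pt_inv; [apply continuity_2d_pt_mult; [apply continuity_2d_pt_const | auto]|]).
        - assert (0 < (S - s) ^ 2) by (apply pow_lt; lra). lra.
        - lra. }
      apply continuity_2d_pt_minus.
      * apply continuity_2d_pt_mult; [exact Ct|]. now apply continuity_2d_pt_mult.
      * apply continuity_2d_pt_mult; [exact C0|].
        apply continuity_2d_pt_mult; [|exact Cchi]. now apply continuity_2d_pt_mult.
    + apply (filter_imp (fun r => 0 < r < S)); [|exact Hloc].
      intros r Hr. apply ex_RInt_cont. intros y. apply continuous_mult_R.
      * apply (heat_solution_Derive_n_continuous u 0); [assumption | lra | lia].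
      * apply continuous_mult_R; [apply continuous_Theta_refl; lra | now apply (smooth_continuous chi 0)].
  - assert (Ht : 0 < S - s) by lra.
    assert (Hk := smooth_kernel (S - s) x0 Ht).
    set (psi := fun y => Theta (S - s) (x0 - y) * chi y).
    assert (Hpsi : smooth psi) by now apply smooth_mult.
    (* The unit margin places [A] and [B] inside an open set where [psi] vanishes, so its derivative
       vanishes there as well. *)
    assert (Hz : forall y, y < A + 1 \/ B - 1 < y -> psi y = 0 /\ Derive psi y = 0).
    { intros y Hy. unfold psi. split.
      - rewrite Hsupp by lra. ring.
      - apply (Derive_n_locally_const psi 0 1); [|lia].
        apply (filter_imp (fun y => y < A + 1 \/ B - 1 < y)).
        + intros v Hv. unfold psi. rewrite Hsupp by lra. ring.
        + revert y Hy. apply (open_or (fun y => y < A + 1)); [apply open_lt | apply open_gt]. }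
    apply is_RInt_unique.
    apply is_RInt_ext with (fun y => plus
      (Derive_n (fun z => u z s) 2 y * psi y - u y s * Derive_n psi 2 y)
      (u y s * cutoff_defect (S - s) x0 chi y)).
    + intros y _. symmetry. eapply eq_trans; [apply is_derive_unique, HD, Hs|].
      unfold psi at 2. rewrite Derive_n_2_mult by assumption.
      replace (Derive_n (fun z => u z s) 2 y) with (Derive (fun r => u y r) s)
        by (assert (H := proj2 Hu y s (proj1 Hs)); lra).
      assert (E : Derive_n (fun y => Theta (S - s) (x0 - y)) 2 y = z2 s y * Theta (S - s) (x0 - y)).
      { rewrite Derive_n_kernel, heat_equation_Theta by assumption. unfold z2. ring. }
      rewrite E. unfold D, cutoff_defect, plus, psi; simpl. ring.
    + replace (RInt (fun y => u y s * cutoff_defect (S - s) x0 chi y) A B)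
        with (plus 0 (RInt (fun y => u y s * cutoff_defect (S - s) x0 chi y) A B))
        by apply (Rplus_0_l _).
      apply @is_RInt_plus.
      * apply Green_zero_boundary; try apply Hz; auto; lra.
      * apply (RInt_correct (V := R_CompleteNormedModule)). apply ex_RInt_cont. intros y.
        apply continuous_mult_R; [apply (heat_solution_Derive_n_continuous u 0); [assumption | lra | lia]|].
        now apply (smooth_continuous _ 0), smooth_cutoff_defect.
Qed.

(** Both [u] and the kernel move with [s]. Uniform continuity on a compact rectangle freezes [u] at
    time [S], at a cost controlled by the mass of the kernel; the approximate identity then applies
    to a fixed function. *)
Lemma tested_solution_limit u chi x0 S A B M : heat_solution u -> smooth chi ->
  (forall y, Rabs (chi y) <= M) -> A < x0 < B -> 0 < S ->
  forall eps, 0 < eps -> exists eta, 0 < eta /\ forall s, 0 < s < S -> S - eta < s ->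
    Rabs (RInt (fun y => u y s * (Theta (S - s) (x0 - y) * chi y)) A B - u x0 S * chi x0) < eps.
Proof.
  intros Hu Hchi HM Hx0 HS eps Heps.
  assert (HM0 : 0 <= M) by (eapply Rle_trans; [apply Rabs_pos | apply (HM 0)]).
  assert (Hc0 : forall y, continuous chi y) by (intros y; apply (smooth_continuous chi 0 y Hchi)).
  assert (Hcu : forall s y, 0 < s -> continuous (fun y => u y s) y).
  { intros s y Hs. apply (heat_solution_Derive_n_continuous u 0 y s Hu Hs). lia. }
  set (e := eps / (2 * (M + 1))).
  assert (He : 0 < e) by (apply Rdiv_lt_0_compat; lra).
  assert (HeM : e * M <= eps / 2).
  { replace (eps / 2) with (e * (M + 1)) by (unfold e; field; lra). nra. }
  destruct (uniform_continuity_2d u A B (S / 2) S) with (eps := mkposreal e He) as [d Hd].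
  { intros y s _ Hs. apply (proj1 Hu y s). lra. }
  simpl in Hd. assert (Hdp := cond_pos d).
  destruct (Theta_approx_identity (fun y => u y S * chi y) x0 A B Hx0) with (eps := eps / 2)
    as (eta & Heta & Happrox).
  { intros y. apply continuous_mult_R; auto. }
  { lra. }
  (* [S / 2] keeps [s] in the rectangle [[A, B] x [S / 2, S]], away from the initial time. *)
  exists (Rmin (Rmin eta d) (S / 2)). split.
  { repeat apply Rmin_pos; lra. }
  intros s Hs Hsm.
  assert (H1 := Rmin_l (Rmin eta d) (S / 2)). assert (H2 := Rmin_r (Rmin eta d) (S / 2)).
  assert (H3 := Rmin_l eta d). assert (H4 := Rmin_r eta d).
  specialize (Happrox (S - s) ltac:(lra)).
  assert (HI := RInt_Theta_bounds (S - s) x0 A B ltac:(lra) Hx0).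
  assert (CT : forall y, continuous (fun y => Theta (S - s) (x0 - y)) y)
    by (intros; apply continuous_Theta_refl; lra).
  set (g1 := fun y => u y s * (Theta (S - s) (x0 - y) * chi y)).
  set (g2 := fun y => u y S * chi y * Theta (S - s) (x0 - y)) in *.
  assert (C1 : forall y, continuous g1 y).
  { intros y. apply continuous_mult_R; [apply Hcu; lra|]. apply continuous_mult_R; auto. }
  assert (C2 : forall y, continuous g2 y).
  { intros y. apply continuous_mult_R; [|apply CT]. apply continuous_mult_R; auto. }
  assert (C12 : forall y, continuous (fun y => g1 y - g2 y) y).
  { intros y. now apply (continuous_minus (V := R_NormedModule) g1 g2). }
  assert (E : RInt g1 A B - RInt g2 A B = RInt (fun y => g1 y - g2 y) A B).
  { symmetry. apply (RInt_minus (V := R_CompleteNormedModule) g1 g2); now apply ex_RInt_cont. }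
  assert (HD : Rabs (RInt (fun y => g1 y - g2 y) A B) <= eps / 2).
  { eapply Rle_trans; [apply abs_RInt_le; [lra | now apply ex_RInt_cont]|].
    apply Rle_trans with (RInt (fun y => e * M * Theta (S - s) (x0 - y)) A B).
    - apply RInt_le; [lra| | |].
      + apply ex_RInt_cont. intros y. apply (continuous_comp _ Rabs); [apply C12 | apply continuous_Rabs].
      + apply ex_RInt_cont. intros y. apply (continuous_scal_r (V := R_NormedModule)). apply CT.
      + intros y Hy. assert (HT := Theta_pos (S - s) (x0 - y) ltac:(lra)).
        unfold g1, g2.
        replace (u y s * (Theta (S - s) (x0 - y) * chi y) - u y S * chi y * Theta (S - s) (x0 - y))
          with ((u y s - u y S) * chi y * Theta (S - s) (x0 - y)) by ring.
        rewrite !Rabs_mult, (Rabs_pos_eq (Theta _ _)) by lra.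
        apply Rmult_le_compat_r; [lra|]. apply Rmult_le_compat; try apply Rabs_pos; [|apply HM].
        apply Rlt_le, Hd; try lra.
        * rewrite Rminus_diag, Rabs_R0. exact Hdp.
        * rewrite Rabs_left; lra.
    - eapply Rle_trans; [right; apply (RInt_scal (V := R_CompleteNormedModule));
        now apply ex_RInt_cont|].
      unfold scal; simpl; unfold mult; simpl. assert (0 <= e * M) by nra. nra. }
  replace (RInt g1 A B - u x0 S * chi x0)
    with (RInt (fun y => g1 y - g2 y) A B + (RInt g2 A B - u x0 S * chi x0)) by (rewrite <- E; ring).
  eapply Rle_lt_trans; [apply Rabs_triang|]. lra.
Qed.

(** * Truncation errors of inverse-square size *)

Definition inv_sq_dist (x0 a b : R) : R := / (x0 - a) ^ 2 + / (b - x0) ^ 2.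

Lemma inv_sq_dist_nonneg x0 a b : a < x0 < b -> 0 <= inv_sq_dist x0 a b.
Proof.
  intros H. apply Rplus_le_le_0_compat; apply Rlt_le, Rinv_0_lt_compat, pow_lt; lra.
Qed.

Lemma div_sq_le E x0 y r : 0 <= E -> 1 <= r -> r <= Rabs (x0 - y) -> E / (x0 - y) ^ 2 <= E * / r ^ 2.
Proof.
  intros HE Hr Hy. apply Rmult_le_compat_l; [exact HE|].
  rewrite <- pow2_abs. apply Rinv_le_contravar; [apply pow_lt; lra|]. apply pow_incr. lra.
Qed.

Lemma RInt_decay_cutoff_error f x0 a b E : 0 <= E -> a <= x0 - 1 -> x0 + 1 <= b ->
  (forall x, continuous f x) ->
  (forall y, 1 <= Rabs (x0 - y) -> Rabs (f y) <= E / (x0 - y) ^ 2) ->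
  Rabs (RInt f (a - 2) (b + 2) - RInt f a b) <= 2 * E * inv_sq_dist x0 a b.
Proof.
  intros HE Ha Hb Hf Hdec.
  eapply Rle_trans;
    [apply (RInt_cutoff_error f a b (E * / (x0 - a) ^ 2) (E * / (b - x0) ^ 2)); auto; [lra| |]|].
  - intros y Hy. assert (Hd : x0 - a <= Rabs (x0 - y)) by (rewrite Rabs_pos_eq; lra).
    eapply Rle_trans; [apply Hdec; lra|]. apply div_sq_le; lra.
  - intros y Hy. assert (Hd : b - x0 <= Rabs (x0 - y)) by (rewrite Rabs_left; lra).
    eapply Rle_trans; [apply Hdec; lra|]. apply div_sq_le; lra.
  - unfold inv_sq_dist. right. ring.
Qed.

Lemma cutoff_defect_bound n T M : 0 < T -> exists D, 0 <= D /\
  forall t x0 y chi, 0 < t <= T -> 1 <= Rabs (x0 - y) -> smooth chi ->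
    (forall k x, Rabs (Derive_n chi k x) <= M k) ->
    Rabs (Derive_n (cutoff_defect t x0 chi) n y) <= D / (x0 - y) ^ 2.
Proof.
  intros HT. destruct (Derive_n_cutoff_kernel_bound T (n + 2) M HT) as (D & HD & HB).
  exists (3 * D). split; [lra|]. intros t x0 y chi Ht Hxy Hchi HM.
  assert (H1 := HB t x0 y n 1%nat 1%nat chi Ht Hxy ltac:(lia) ltac:(lia) Hchi HM).
  assert (H2 := HB t x0 y n 0%nat 2%nat chi Ht Hxy ltac:(lia) ltac:(lia) Hchi HM).
  assert (Hk := smooth_kernel t x0 (proj1 Ht)).
  assert (S1 : smooth (fun y => Derive_n (fun y => Theta t (x0 - y)) 1 y * Derive_n chi 1 y)).
  { apply smooth_mult; now apply smooth_Derive_n. }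
  assert (S2 : smooth (fun y => Derive_n (fun y => Theta t (x0 - y)) 0 y * Derive_n chi 2 y)).
  { apply smooth_mult; now apply smooth_Derive_n. }
  change (cutoff_defect t x0 chi) with (fun y =>
    2 * (Derive_n (fun y => Theta t (x0 - y)) 1 y * Derive_n chi 1 y)
    + Derive_n (fun y => Theta t (x0 - y)) 0 y * Derive_n chi 2 y).
  rewrite (Derive_n_plus_smooth (fun y => 2 * _)); [|apply smooth_mult; [apply smooth_const | exact S1] | exact S2].
  rewrite Derive_n_scal_l.
  eapply Rle_trans; [apply Rabs_triang|]. rewrite Rabs_mult, (Rabs_pos_eq 2) by lra.
  unfold Rdiv in *. lra.
Qed.

(** [D] is chosen before [u], [chi], [a], [b] and [s0]. Independence of [s0] allows [s0 -> 0];
    independence of [a] and [b] allows the cutoff to recede. *)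
Lemma heat_solution_evolution n T M C : (1 <= n)%nat -> 0 < T -> 0 <= C -> exists D, 0 <= D /\
  forall (u U : R -> R -> R) (chi : R -> R) x0 a b s0, heat_solution u ->
    (forall t, 0 < t -> (forall x, continuous (U t) x) /\ (forall x, Rabs (U t x) <= C) /\
       dist_deriv_eq n (U t) (fun x => u x t)) ->
    a <= x0 - 1 -> x0 + 1 <= b -> is_cutoff M a b chi -> 0 < s0 ->
    Rabs (u x0 (s0 + T) - RInt (fun y => u y s0 * (Theta T (x0 - y) * chi y)) (a - 2) (b + 2))
      <= D * inv_sq_dist x0 a b.
Proof.
  intros Hn HT HC. destruct (cutoff_defect_bound n T M HT) as (D & HD & HB).
  exists (2 * (C * D) * T). split.
  { assert (0 <= C * D) by nra. nra. }
  intros u U chi x0 a b s0 Hu HU Ha Hb (Hchi & Hchi1 & Hchi0 & HM) Hs0.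
  set (S := s0 + T).
  set (J := fun s => RInt (fun y => u y s * (Theta (S - s) (x0 - y) * chi y)) (a - 2) (b + 2)).
  set (J' := fun s => RInt (fun y => u y s * cutoff_defect (S - s) x0 chi y) (a - 2) (b + 2)).
  assert (Hinv := inv_sq_dist_nonneg x0 a b ltac:(lra)).
  assert (HJ : forall s, s0 <= s < S -> is_derive J s (J' s)).
  { intros s Hs. apply is_derive_tested_solution; auto; [|lra].
    intros y Hy. apply Hchi0. lra. }
  assert (HJ' : forall s, s0 <= s < S -> Rabs (J' s) <= 2 * (C * D) * inv_sq_dist x0 a b).
  { intros s Hs. unfold J'. set (rho := cutoff_defect (S - s) x0 chi).
    assert (Ht : 0 < S - s <= T) by (unfold S in *; lra).
    assert (Hrho : smooth rho) by (apply smooth_cutoff_defect; [lra | auto]).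
    destruct (HU s ltac:(lra)) as (HUc & HUb & HUd).
    (* Every term of the defect contains a derivative of [chi]. This is used with [c = 0] outside
       the support and with [c = 1] between [a] and [b]. *)
    assert (Hfl : forall P : R -> Prop, open P -> forall c, (forall y, P y -> chi y = c) ->
      forall y, P y -> rho y = 0).
    { intros P HP c Hc y Hy. unfold rho, cutoff_defect.
      assert (Hl : locally y (fun z => chi z = c)).
      { apply (filter_imp P); [exact Hc | now apply HP]. }
      change (Derive chi y) with (Derive_n chi 1 y).
      rewrite !(Derive_n_locally_const chi c _ y Hl) by lia. ring. }
    assert (Hsupp : supp_in rho (a - 2) (b + 2)).
    { intros y Hy.
      apply (Hfl (fun y => y < a - 2 \/ b + 2 < y)
        (open_or (fun y => y < a - 2) (fun y => b + 2 < y) (open_lt _) (open_gt _)) 0); [|exact Hy].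
      intros z Hz. apply Hchi0. lra. }
    assert (Hmid : forall y, a < y < b -> Derive_n rho n y = 0).
    { intros y Hy. apply (Derive_n_locally_const rho 0); [|exact Hn].
      assert (Ho : open (fun z => a < z /\ z < b)) by (apply open_and; [apply open_gt | apply open_lt]).
      apply (filter_imp (fun z => a < z /\ z < b)); [|now apply Ho].
      apply (Hfl _ Ho 1). intros z Hz. apply Hchi1. lra. }
    specialize (HUd rho (a - 2) (b + 2) ltac:(lra) Hrho Hsupp).
    set (f := fun x => U s x * Derive_n rho n x).
    change (RInt f (a - 2) (b + 2)
      = (-1) ^ n * RInt (fun x => u x s * rho x) (a - 2) (b + 2)) in HUd.
    assert (Ef : RInt f a b = 0).
    { eapply eq_trans; [apply (RInt_ext _ (fun _ => 0))|].
      - rewrite Rmin_left, Rmax_right by lra. intros y Hy. unfold f. rewrite Hmid by exact Hy.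
        apply Rmult_0_r.
      - rewrite RInt_const. apply Rmult_0_r. }
    (* Here the unknown growth of [u] is traded for the bound [C] on its primitive. *)
    assert (Ea : Rabs (RInt (fun y => u y s * rho y) (a - 2) (b + 2)) = Rabs (RInt f (a - 2) (b + 2))).
    { rewrite HUd, Rabs_mult, pow_1_abs. ring. }
    rewrite Ea. replace (RInt f (a - 2) (b + 2)) with (RInt f (a - 2) (b + 2) - RInt f a b)
      by (rewrite Ef; ring).
    apply RInt_decay_cutoff_error; auto; [nra| |].
    - intros y. apply continuous_mult_R; [apply HUc | now apply smooth_continuous].
    - intros y Hy. unfold f. rewrite Rabs_mult. unfold Rdiv. rewrite Rmult_assoc.
      apply Rmult_le_compat; try apply Rabs_pos; [apply HUb|]. now apply HB. }
  assert (HTS : S - s0 = T) by (unfold S; ring).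
  replace (RInt (fun y => u y s0 * (Theta T (x0 - y) * chi y)) (a - 2) (b + 2)) with (J s0)
    by (unfold J; now rewrite HTS).
  apply le_epsilon. intros eps Heps.
  destruct (tested_solution_limit u chi x0 S (a - 2) (b + 2) (M O) Hu Hchi (HM O)) with (eps := eps)
    as (eta & Heta & Hlim); [lra | unfold S; lra | exact Heps |].
  rewrite (Hchi1 x0), Rmult_1_r in Hlim by lra.
  (* The kernel degenerates at [s = S], so the mean value theorem is applied only up to [s1 < S].
     [S - T / 2] ensures [s0 < s1], and [S - eta / 2] places [s1] where [Hlim] holds. *)
  set (s1 := Rmax (S - eta / 2) (S - T / 2)).
  assert (Hs1 : s0 < s1 < S).
  { unfold s1. split; [|apply Rmax_lub_lt; lra].
    eapply Rlt_le_trans; [|apply Rmax_r]. unfold S. lra. }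
  assert (Hs1' : S - eta < s1).
  { eapply Rlt_le_trans; [|apply Rmax_l]. lra. }
  specialize (Hlim s1 ltac:(lra) Hs1'). fold (J s1) in Hlim.
  destruct (MVT_gen J s0 s1 J') as (c & Hc & Hmvt).
  { rewrite Rmin_left, Rmax_right by lra. intros s Hs. apply HJ. lra. }
  { rewrite Rmin_left, Rmax_right by lra. intros s Hs. apply continuity_pt_filterlim.
    apply (@ex_derive_continuous R_AbsRing R_NormedModule). exists (J' s). apply HJ. lra. }
  rewrite Rmin_left, Rmax_right in Hc by lra.
  assert (HE : Rabs (J s1 - J s0) <= 2 * (C * D) * T * inv_sq_dist x0 a b).
  { rewrite Hmvt, Rabs_mult, (Rabs_pos_eq (s1 - s0)) by lra.
    replace (2 * (C * D) * T * inv_sq_dist x0 a b) with (2 * (C * D) * inv_sq_dist x0 a b * T) by ring.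
    apply Rmult_le_compat; [apply Rabs_pos | lra | apply HJ'; lra | unfold S in *; lra]. }
  replace (u x0 S - J s0) with (- (J s1 - u x0 S) + (J s1 - J s0)) by ring.
  eapply Rle_trans; [apply Rabs_triang|]. rewrite Rabs_Ropp. lra.
Qed.

(** As [s0 -> 0], the test function [psi] stays fixed: [u x0 (s0 + T)] converges by continuity, and
    the primitives converge uniformly, which suffices on a bounded interval. *)
Lemma cutoff_representation_error n T M C : (1 <= n)%nat -> 0 < T -> 0 <= C -> exists D, 0 <= D /\
  forall (u U : R -> R -> R) (F chi : R -> R) x0 a b, heat_solution u ->
    (forall t, 0 < t -> (forall x, continuous (U t) x) /\ (forall x, Rabs (U t x) <= C) /\
       dist_deriv_eq n (U t) (fun x => u x t)) ->
    (forall x, continuous F x) ->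
    (forall eps, 0 < eps -> exists eta, 0 < eta /\
       forall t x, 0 < t < eta -> Rabs (U t x - F x) <= eps) ->
    a <= x0 - 1 -> x0 + 1 <= b -> is_cutoff M a b chi ->
    Rabs (u x0 T - (-1) ^ n *
        RInt (fun y => F y * Derive_n (fun y => Theta T (x0 - y) * chi y) n y) (a - 2) (b + 2))
      <= D * inv_sq_dist x0 a b.
Proof.
  intros Hn HT HC. destruct (heat_solution_evolution n T M C Hn HT HC) as (D & HD & HE).
  exists D. split; [exact HD|].
  intros u U F chi x0 a b Hu HU HF HUF Ha Hb Hcut.
  assert (Hchi := proj1 Hcut). assert (Hchi0 := proj1 (proj2 (proj2 Hcut))).
  set (psi := fun y => Theta T (x0 - y) * chi y).
  assert (Hpsi : smooth psi) by (apply smooth_mult; [now apply smooth_kernel | exact Hchi]).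
  assert (Hsupp : supp_in psi (a - 2) (b + 2)).
  { intros y Hy. unfold psi. rewrite Hchi0 by lra. ring. }
  destruct (bounded_continuity (V := R_NormedModule) (Derive_n psi n) (a - 2) (b + 2)) as [W HW].
  { intros y _. now apply smooth_continuous. }
  assert (HW0 : 0 < W).
  { eapply Rle_lt_trans; [apply (Rabs_pos (Derive_n psi n a)) | apply (HW a); lra]. }
  apply le_epsilon. intros eps Heps.
  (* Chosen so that [e], times the bound [W] on the derivative of [psi], times the length
     [b - a + 4], equals [eps / 2]. *)
  set (e := eps / (2 * ((b - a + 4) * W))).
  assert (HbW : 0 < (b - a + 4) * W) by (apply Rmult_lt_0_compat; lra).
  assert (He : 0 < e) by (apply Rdiv_lt_0_compat; lra).
  destruct (HUF e He) as (eta & Heta & HUFe).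
  assert (Hcont : continuity_2d_pt u x0 T) by apply (proj1 Hu x0 T HT).
  assert (Heps2 : 0 < eps / 2) by lra.
  destruct (Hcont (mkposreal _ Heps2)) as [d Hd]. simpl in Hd. assert (Hdp := cond_pos d).
  set (s0 := Rmin eta d / 2).
  assert (Hmin : 0 < Rmin eta d) by now apply Rmin_pos.
  assert (Hm1 := Rmin_l eta d). assert (Hm2 := Rmin_r eta d).
  assert (Hs0 : 0 < s0) by (unfold s0; lra).
  assert (H1 : Rabs (u x0 (s0 + T) - u x0 T) < eps / 2).
  { apply Hd; [rewrite Rminus_diag, Rabs_R0; exact Hdp|].
    replace (s0 + T - T) with s0 by ring. rewrite Rabs_pos_eq by lra. unfold s0. lra. }
  assert (H2 := HE u U chi x0 a b s0 Hu HU Ha Hb Hcut Hs0).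
  destruct (HU s0 Hs0) as (HUc & _ & HUd).
  specialize (HUd psi (a - 2) (b + 2) ltac:(lra) Hpsi Hsupp).
  assert (Hsgn : (-1) ^ n * (-1) ^ n = 1).
  { rewrite <- Rpow_mult_distr. replace (-1 * -1) with 1 by ring. apply pow1. }
  assert (EJ : RInt (fun y => u y s0 * psi y) (a - 2) (b + 2)
    = (-1) ^ n * RInt (fun y => U s0 y * Derive_n psi n y) (a - 2) (b + 2)).
  { rewrite HUd, <- Rmult_assoc, Hsgn. symmetry. apply Rmult_1_l. }
  set (I1 := RInt (fun y => U s0 y * Derive_n psi n y) (a - 2) (b + 2)) in *.
  set (I2 := RInt (fun y => F y * Derive_n psi n y) (a - 2) (b + 2)).
  assert (Cpsi : forall y, continuous (Derive_n psi n) y) by (intros; now apply smooth_continuous).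
  assert (C1 : forall y, continuous (fun y => U s0 y * Derive_n psi n y) y).
  { intros y. now apply continuous_mult_R. }
  assert (C2 : forall y, continuous (fun y => F y * Derive_n psi n y) y).
  { intros y. now apply continuous_mult_R. }
  assert (H3 : Rabs (I1 - I2) <= eps / 2).
  { replace (I1 - I2)
      with (RInt (fun y => U s0 y * Derive_n psi n y - F y * Derive_n psi n y) (a - 2) (b + 2)).
    2:{ apply (RInt_minus (V := R_CompleteNormedModule)); now apply ex_RInt_cont. }
    eapply Rle_trans; [apply (abs_RInt_le_const _ _ _ (e * W)); [lra| |]|].
    - apply ex_RInt_cont. intros y. now apply (continuous_minus (V := R_NormedModule)).
    - intros y Hy. rewrite <- Rmult_minus_distr_r, Rabs_mult.
      apply Rmult_le_compat; try apply Rabs_pos.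
      + apply HUFe. unfold s0. lra.
      + apply Rlt_le, (HW y Hy).
    - right. unfold e. field. lra. }
  unfold psi in EJ at 1. rewrite EJ in H2.
  replace (u x0 T - (-1) ^ n * I2)
    with (- (u x0 (s0 + T) - u x0 T) + (u x0 (s0 + T) - (-1) ^ n * I1) + (-1) ^ n * (I1 - I2)) by ring.
  eapply Rle_trans; [apply Rabs_triang|]. rewrite (Rabs_mult ((-1) ^ n)), pow_1_abs.
  eapply Rle_trans; [apply Rplus_le_compat_r, Rabs_triang|]. rewrite Rabs_Ropp. lra.
Qed.

(** The cutoff disappears: on [(a, b)] it equals 1, and the two strips contribute an error of the
    same inverse-square size. *)
Lemma truncated_representation_error n T C : (1 <= n)%nat -> 0 < T -> 0 <= C -> exists D, 0 <= D /\
  forall (u U : R -> R -> R) (F : R -> R) x0 a b, heat_solution u ->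
    (forall t, 0 < t -> (forall x, continuous (U t) x) /\ (forall x, Rabs (U t x) <= C) /\
       dist_deriv_eq n (U t) (fun x => u x t)) ->
    (forall x, continuous F x) -> (forall x, Rabs (F x) <= C) ->
    (forall eps, 0 < eps -> exists eta, 0 < eta /\
       forall t x, 0 < t < eta -> Rabs (U t x - F x) <= eps) ->
    a <= x0 - 1 -> x0 + 1 <= b ->
    Rabs (u x0 T - RInt (fun y => F y * Theta_d n T (x0 - y)) a b) <= D * inv_sq_dist x0 a b.
Proof.
  intros Hn HT HC. destruct exists_smooth_cutoff as [M HM].
  destruct (cutoff_representation_error n T M C Hn HT HC) as (D1 & HD1 & HR).
  destruct (Derive_n_cutoff_kernel_bound T n M HT) as (D2 & HD2 & HB).
  exists (D1 + 2 * (C * D2)). split; [nra|].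
  intros u U F x0 a b Hu HU HF HFC HUF Ha Hb.
  destruct (HM a b ltac:(lra)) as (chi & Hcut). assert (Hc := Hcut).
  destruct Hc as (Hchi & Hchi1 & _ & HMchi).
  specialize (HR u U F chi x0 a b Hu HU HF HUF Ha Hb Hcut).
  set (psi := fun y => Theta T (x0 - y) * chi y) in *.
  assert (Hpsi : smooth psi) by (apply smooth_mult; [now apply smooth_kernel | exact Hchi]).
  set (f := fun y => F y * Derive_n psi n y) in *.
  assert (Hf : forall y, continuous f y).
  { intros y. apply continuous_mult_R; [apply HF | now apply smooth_continuous]. }
  assert (Hsgn : (-1) ^ n * (-1) ^ n = 1).
  { rewrite <- Rpow_mult_distr. replace (-1 * -1) with 1 by ring. apply pow1. }
  (* The sign of the distributional derivative cancels the sign from differentiating [n] times in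
     the reflected variable [x0 - y]. *)
  assert (Ef : RInt (fun y => F y * Theta_d n T (x0 - y)) a b = (-1) ^ n * RInt f a b).
  { eapply eq_trans; [|apply (RInt_scal (V := R_CompleteNormedModule)); now apply ex_RInt_cont].
    apply RInt_ext. rewrite Rmin_left, Rmax_right by lra. intros y Hy.
    unfold f, scal; simpl; unfold mult; simpl.
    replace (Derive_n psi n y) with (Derive_n (fun y => Theta T (x0 - y)) n y).
    - rewrite Derive_n_kernel by exact HT. unfold Theta_d.
      replace ((-1) ^ n * (F y * ((-1) ^ n * Derive_n (Theta T) n (x0 - y))))
        with ((-1) ^ n * (-1) ^ n * (F y * Derive_n (Theta T) n (x0 - y))) by ring.
      rewrite Hsgn. ring.
    - apply Derive_n_ext_loc.
      apply (filter_imp (fun z => a < z /\ z < b)).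
      + intros z Hz. unfold psi. rewrite Hchi1 by lra. ring.
      + apply (open_and (fun z => a < z) (fun z => z < b)); [apply open_gt | apply open_lt | exact Hy]. }
  rewrite Ef.
  assert (HX : Rabs (RInt f (a - 2) (b + 2) - RInt f a b) <= 2 * (C * D2) * inv_sq_dist x0 a b).
  { apply RInt_decay_cutoff_error; auto; [nra|].
    intros y Hy. unfold f. rewrite Rabs_mult. unfold Rdiv. rewrite Rmult_assoc.
    apply Rmult_le_compat; try apply Rabs_pos; [apply HFC|].
    apply (HB T x0 y n 0%nat 0%nat chi); auto; [lra | lia | lia]. }
  replace (u x0 T - (-1) ^ n * RInt f a b) with ((u x0 T - (-1) ^ n * RInt f (a - 2) (b + 2))
    + (-1) ^ n * (RInt f (a - 2) (b + 2) - RInt f a b)) by ring.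
  eapply Rle_trans; [apply Rabs_triang|]. rewrite (Rabs_mult ((-1) ^ n)), pow_1_abs. lra.
Qed.

(** * From truncated integrals to the convolution *)

Lemma is_RInt_gen_truncation_error (f : R -> R) x0 l D :
  (forall x, continuous f x) -> 0 <= D ->
  (forall a b, a <= x0 - 1 -> x0 + 1 <= b -> Rabs (l - RInt f a b) <= D * inv_sq_dist x0 a b) ->
  is_RInt_gen f (Rbar_locally m_infty) (Rbar_locally p_infty) l.
Proof.
  intros Hf HD Herr P [eps HP]. assert (Heps := cond_pos eps).
  (* [r >= 1] allows [/ r^2 <= / r], and the second entry makes each of the two tails at most
     [eps / 4]; [D + 1] covers [D = 0]. *)
  set (r := Rmax 1 (4 * (D + 1) / eps)).
  assert (Hr1 := Rmax_l 1 (4 * (D + 1) / eps) : 1 <= r).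
  assert (Hr2 := Rmax_r 1 (4 * (D + 1) / eps) : 4 * (D + 1) / eps <= r).
  assert (Hinv : / r ^ 2 <= / r).
  { apply Rinv_le_contravar; [lra|]. simpl. nra. }
  assert (HDr : (D + 1) * / r <= eps / 4).
  { apply (Rmult_le_reg_r r); [lra|]. rewrite Rmult_assoc, Rinv_l, Rmult_1_r by lra.
    apply (Rmult_le_compat_l (eps / 4)) in Hr2; [|lra].
    replace (eps / 4 * (4 * (D + 1) / eps)) with (D + 1) in Hr2 by (field; lra). exact Hr2. }
  assert (Hri : 0 < / r) by (apply Rinv_0_lt_compat; lra).
  apply (Filter_prod _ _ _ (fun a => a < x0 - r) (fun b => x0 + r < b)).
  - exists (x0 - r). auto.
  - exists (x0 + r). auto.
  - intros a b Ha Hb. exists (RInt f a b). split.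
    + apply (RInt_correct (V := R_CompleteNormedModule)). now apply ex_RInt_cont.
    + apply HP. change (Rabs (RInt f a b - l) < eps). rewrite Rabs_minus_sym.
      eapply Rle_lt_trans; [apply Herr; lra|].
      assert (HI : forall d, r <= d -> / d ^ 2 <= / r ^ 2).
      { intros d Hd. apply Rinv_le_contravar; [apply pow_lt; lra | apply pow_incr; lra]. }
      assert (H1 := HI (x0 - a) ltac:(lra)). assert (H2 := HI (b - x0) ltac:(lra)).
      unfold inv_sq_dist. nra.
Qed.

(** Removes the boundary term [F(oo) g(oo)] from [heat_conv]. *)
Lemma Lim_kernel_p_infty T k x : 0 < T -> real (Lim (fun xi => Theta_d k T (x - xi)) p_infty) = 0.
Proof.
  intros HT. destruct (Derive_n_Theta_bound T k 1 HT) as (C & HC & HB).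
  rewrite (is_lim_unique _ p_infty 0); [reflexivity|].
  apply is_lim_spec. intros eps. assert (Heps := cond_pos eps).
  set (r := Rmax 1 (2 * (C * T + 1) / eps)).
  assert (Hr1 := Rmax_l 1 (2 * (C * T + 1) / eps) : 1 <= r).
  assert (Hr2 := Rmax_r 1 (2 * (C * T + 1) / eps) : 2 * (C * T + 1) / eps <= r).
  exists (x + r). intros y Hy. rewrite Rminus_0_r. unfold Theta_d.
  assert (Hxy : r <= Rabs (x - y)) by (rewrite Rabs_left; lra).
  eapply Rle_lt_trans; [apply HB; lra|]. rewrite pow_1.
  assert (HCT : 0 <= C * T) by nra.
  replace (C * (T / (x - y) ^ 2)) with (C * T / (x - y) ^ 2).
  2:{ unfold Rdiv. ring. }
  eapply Rle_lt_trans; [apply (div_sq_le _ _ _ r); lra|].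
  apply (Rmult_lt_reg_r (r ^ 2)); [apply pow_lt; lra|].
  rewrite Rmult_assoc, Rinv_l, Rmult_1_r by (apply pow_nonzero; lra).
  apply (Rmult_le_compat_l eps) in Hr2; [|lra].
  replace (eps * (2 * (C * T + 1) / eps)) with (2 * (C * T + 1)) in Hr2 by (field; lra).
  simpl. nra.
Qed.

(** The minus sign before the Stieltjes integral cancels the one from differentiating in [x - xi],
    leaving [F] against the [n]-th derivative of the kernel. *)
Lemma heat_conv_eq n F t x l : (1 <= n)%nat -> 0 < t ->
  is_RInt_gen (fun y => F y * Theta_d n t (x - y)) (Rbar_locally m_infty) (Rbar_locally p_infty) l ->
  heat_conv n F t x = l.
Proof.
  intros Hn Ht Hl. unfold heat_conv. rewrite Lim_kernel_p_infty, Rmult_0_r by exact Ht.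
  assert (HD : (fun xi => F xi * Derive (fun xi => Theta_d (n - 1) t (x - xi)) xi)
    = (fun xi => opp (F xi * Theta_d n t (x - xi)))).
  { apply functional_extensionality. intros xi. unfold opp; simpl.
    rewrite Ropp_mult_distr_r. f_equal. apply is_derive_unique.
    assert (Hd : ex_derive (Theta_d (n - 1) t) (x - xi)).
    { apply (smooth_ex_derive (Derive_n (Theta t) (n - 1))).
      now apply smooth_Derive_n, smooth_Theta. }
    apply Derive_correct in Hd. evar_last.
    - apply (is_derive_comp (Theta_d (n - 1) t) (fun xi => x - xi)); [exact Hd|].
      auto_derive; [exact I | reflexivity].
    - unfold scal; simpl; unfold mult; simpl.
      change (Derive (Theta_d (n - 1) t) (x - xi)) with (Theta_d (S (n - 1)) t (x - xi)).
      replace (S (n - 1)) with n by lia. ring. }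
  rewrite HD, (is_RInt_gen_unique _ (opp l)).
  - unfold opp; simpl. ring.
  - exact (is_RInt_gen_opp _ l Hl).
Qed.

Theorem theorem6p5 (n : nat) (u : R -> R -> R) (Fu : R -> R -> R) (F : R -> R) :
  (2 <= n)%nat ->
  (* regularity: u in C^{2,1} on R x (0,oo) *)
  (forall x t, 0 < t ->
     ex_derive (fun y => u y t) x /\
     ex_derive (fun y => Derive (fun z => u z t) y) x /\
     ex_derive (fun s => u x s) t /\
     continuity_2d_pt u x t /\
     continuity_2d_pt (fun y s => Derive (fun z => u z s) y) x t /\
     continuity_2d_pt (fun y s => Derive_n (fun z => u z s) 2 y) x t /\
     continuity_2d_pt (fun y s => Derive (fun r => u y r) s) x t) ->
  (* heat equation *)
  (forall x t, 0 < t ->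
     Derive (fun s => u x s) t - Derive_n (fun z => u z t) 2 x = 0) ->
  (* u(.,t) in A_c^n with primitive Fu t in B_c *)
  (forall t, 0 < t -> in_Bc (Fu t) /\ dist_deriv_eq n (Fu t) (fun x => u x t)) ->
  (* ||u(.,t)||^(n) bounded for t > 0 *)
  (exists C : R, forall t, 0 < t -> Anorm (Fu t) <= C) ->
  (* f = F^(n) in A_c^n *)
  in_Bc F ->
  (* ||u(.,t) - f||^(n) -> 0 as t -> 0+ *)
  filterlim (fun t => Anorm (fun x => Fu t x - F x)) (at_right 0) (locally 0) ->
  forall x t, 0 < t -> u x t = heat_conv n F t x.
Proof.
  intros Hn Hreg Hheat HU [C0 HC0] HF Hlim x t Ht.
  destruct (in_Bc_bounded F HF) as [C1 HC1].
  (* One constant must bound both the primitives [Fu t] and their limit [F]. *)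
  set (C := Rmax C0 C1).
  assert (HFC : forall y, Rabs (F y) <= C).
  { intros y. eapply Rle_trans; [apply HC1 | apply Rmax_r]. }
  assert (HC : 0 <= C) by (eapply Rle_trans; [apply Rabs_pos | apply (HFC 0)]).
  destruct (truncated_representation_error n t C ltac:(lia) Ht HC) as (D & HD & Herr).
  symmetry. apply heat_conv_eq; [lia | exact Ht |].
  apply (is_RInt_gen_truncation_error _ x _ D); [|exact HD|].
  - intros y. apply continuous_mult_R; [apply HF|].
    apply (continuous_comp (fun y => x - y) (Theta_d n t)).
    + apply (@ex_derive_continuous R_AbsRing R_NormedModule). auto_derive. exact I.
    + now apply smooth_continuous, smooth_Theta.
  - intros a b Ha Hb. apply (Herr u Fu F); auto.
    + split; assumption.
    + intros s Hs. destruct (HU s Hs) as [HB Hd]. split; [apply HB | split; [|exact Hd]].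
      intros y. eapply Rle_trans; [now apply Rabs_le_Anorm|].
      eapply Rle_trans; [now apply HC0 | apply Rmax_l].
    + apply HF.
    (* [Rabs_le_Anorm], applied to the difference of the primitives, turns convergence in norm into
       convergence uniform in space. *)
    + intros eps Heps.
      destruct (proj1 (filterlim_locally _ _) Hlim (mkposreal eps Heps)) as [d Hd].
      exists d. split; [apply cond_pos|]. intros s y Hs.
      eapply Rle_trans; [apply (Rabs_le_Anorm (fun x => Fu s x - F x))|].
      * apply in_Bc_minus; [now apply HU | exact HF].
      * assert (Hb' : ball 0 eps (Anorm (fun x => Fu s x - F x))).
        { apply (Hd s); [|lra]. change (Rabs (s - 0) < d). rewrite Rabs_pos_eq; lra. }
        change (Rabs (Anorm (fun x => Fu s x - F x) - 0) < eps) in Hb'.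
        rewrite Rminus_0_r in Hb'. apply Rabs_def2 in Hb'. lra.
Qed.
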